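(* Let $r\ge 1$, let $(A;M_1,\dots,M_r)$ be an admissible system (as defined in the context), let $(D,\delta)$ be a decoration of $A$, and let $\mathcal{A}=\mathcal{A}_D$ be the associated $C^*$-algebra with generators $s_{u,v}$. Let $\mathcal{H}$ be a Hilbert space and for each $u,v\in\overline W$ with $t(u)=t(v)$ let $S_{u,v}\in\mathcal{B}(\mathcal{H})$ be a nonzero partial isometry. Suppose the $S_{u,v}$ satisfy the relations: $S_{u,v}^*=S_{v,u}$; $S_{u,v}S_{v,w}=S_{u,w}$; $S_{u,v}=\sum_{w\in W,\ \sigma(w)=e_j,\ o(w)=t(u)=t(v)}S_{uw,vw}$ for each $1\le j\le r$; and $S_{u,u}S_{v,v}=0$ for $u,v\in\overline W_0$, $u\ne v$. Let $\hat{\mathcal{A}}$ denote the $C^*$-algebra generated by the $S_{u,v}$. Then there is a unique $*$-isomorphism $\phi$ from $\mathcal{A}$ onto $\hat{\mathcal{A}}$ such that $\phi(s_{u,v})=S_{u,v}$ for all $u,v\in\overline W$ with $t(u)=t(v)$.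
   Context: Notation. $\mathbb{Z}_+$ is the set of nonnegative integers, $e_1,\dots,e_r$ is the standard basis of $\mathbb{Z}^r$; for $m,n\in\mathbb{Z}^r$, $m\le n$ is meant coordinatewise and $[m,n]=\{k\in\mathbb{Z}^r: m\le k\le n\}$. Words. Let $A$ be a finite nonempty set (the alphabet) and $M_1,\dots,M_r$ matrices with entries $M_j(b,a)$, $a,b\in A$. For $m\in\mathbb{Z}_+^r$ let $W_m$ be the set of maps $w:[0,m]\to A$ with $M_j(w(l+e_j),w(l))=1$ whenever $l,l+e_j\in[0,m]$ (words of shape $m$). For $w\in W_m$ put $\sigma(w)=m$, $o(w)=w(0)$, $t(w)=w(m)$. Let $W=\bigcup_m W_m$ and identify $A$ with $W_0$. For $0\le k\le l\le m$ and $w\in W_m$, $w|_{[k,l]}\in W_{l-k}$ is $i\mapsto w(i+k)$. For $0\ne p\in\mathbb{Z}^r$, a word $w\in W_l$ is $p$-periodic if $w(j)=w(j-p)$ for all $j\in[0,l]\cap[p,p+l]$. Admissible system. $(A;M_1,\dots,M_r)$ is called admissible if: (H0) each $M_i$ is a nonzero $\{0,1\}$-matrix; (H1) whenever $u\in W_m$, $v\in W_n$ and $t(u)=o(v)$ there is a unique $w\in W_{m+n}$ with $w|_{[0,m]}=u$ and $w|_{[m,m+n]}=v$ (this $w$ is written $uv$); (H2) the directed graph with vertex set $A$ and a directed edge from $a$ to $b$ for each $i$ with $M_i(b,a)=1$ is irreducible (there is a directed path from any vertex to any vertex); (H3) for each $p\in\mathbb{Z}^r$, $p\ne0$, there is some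 $w\in W$ which is not $p$-periodic. Decorations. A decoration is a nonempty finite or countable set $D$ with a map $\delta:D\to A$. Put $\overline W_m=\{(d,w)\in D\times W_m: o(w)=\delta(d)\}$, $\overline W=\bigcup_m\overline W_m$, with $o(d,w)=d$, $t(d,w)=t(w)$, $\sigma(d,w)=\sigma(w)$; identify $D$ with $\overline W_0$. For $\overline u=(d,u)\in\overline W$ and $v\in W$ with $t(u)=o(v)$ put $\overline u v=(d,uv)$. The algebra. $\mathcal{A}=\mathcal{A}_D$ is the universal $C^*$-algebra generated by partial isometries $s_{u,v}$, for $u,v\in\overline W$ with $t(u)=t(v)$, subject to the relations $s_{u,v}^*=s_{v,u}$; $s_{u,v}s_{v,w}=s_{u,w}$; $s_{u,v}=\sum s_{uw,vw}$ for each $1\le j\le r$, the sum being over all $w\in W$ with $\sigma(w)=e_j$ and $o(w)=t(u)=t(v)$; $s_{u,u}s_{v,v}=0$ for $u,v\in\overline W_0$, $u\ne v$. *)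

(* Defs.v *)
From HB Require Import structures.
From mathcomp Require Import all_boot all_order all_algebra.
From mathcomp Require Import sesquilinear.
From mathcomp Require Import complex.
From mathcomp Require Import all_classical all_reals all_analysis.
From mathcomp Require Import ring lra.

Set Implicit Arguments.
Unset Strict Implicit.
Unset Printing Implicit Defensive.

Import Order.TTheory GRing.Theory Num.Theory.
Import numFieldNormedType.Exports.

Local Open Scope classical_set_scope.
Local Open Scope ring_scope.

(* The norm of a normed module over R[i] takes its values in R[i], in the
   copy of the nonnegative reals. *)

Record cstarAlgType (R : realType) := CstarAlg {
  csort :> completeNormedModType R[i];
  cmul : {bilinear csort -> csort -> csort};
  cstar : csort -> csort;
  cmulA : associative cmul;
  cnormM : forall x y, `|cmul x y| <= `|x| * `|y|;
  cstarL : forall a x y, cstar (a *: x + y) = a^* *: cstar x + cstar y;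
  cstarK : involutive cstar;
  cstarM : forall x y, cstar (cmul x y) = cmul (cstar y) (cstar x);
  cnormCstar : forall x, `|cmul (cstar x) x| = `|x| ^+ 2 }.

Notation "x *c y" := (cmul _ x y) (at level 40, left associativity) : ring_scope.

Record hilbertType (R : realType) := Hilbert {
  hsort :> completeNormedModType R[i];
  hdot : {dot hsort for (@Num.conj R[i])};
  hdotE : forall x, `|x| ^+ 2 = hdot x x }.

Section Bop.
Variables (R : realType) (H : hilbertType R).

Record bop := Bop {
  bfun :> H -> H;
  bop_linear : linear bfun;
  bop_bounded : exists c : R[i], forall x, `|bfun x| <= c * `|x| }.

Lemma bopP (S T : bop) : bfun S =1 bfun T -> S = T.
Proof.
case: S T => f fl fb [g gl gb] /= /funext fg; subst g.
by rewrite (Prop_irrelevance fl gl) (Prop_irrelevance fb gb).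
Qed.

Implicit Types (S T : bop).

HB.instance Definition _ := gen_eqMixin bop.
HB.instance Definition _ := gen_choiceMixin bop.

HB.instance Definition _ (S : bop) :=
  GRing.isLinear.Build R[i] H H *:%R (bfun S) (@bop_linear S).

Let zero_lin : linear (fun _ : H => (0 : H)).
Proof. by move=> a x y; rewrite scaler0 addr0. Qed.
Let zero_bnd : exists c : R[i], forall x : H, `|0 : H| <= c * `|x|.
Proof. by exists 0 => x; rewrite normr0 mul0r. Qed.
Definition bop0 := Bop zero_lin zero_bnd.

Let opp_lin (S : bop) : linear (fun x => - S x).
Proof. by move=> a x y; rewrite linearP opprD scalerN. Qed.
Let opp_bnd (S : bop) : exists c : R[i], forall x, `|- S x| <= c * `|x|.
Proof. by have [c hc] := bop_bounded S; exists c => x; rewrite normrN. Qed.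
Definition bopN S := Bop (opp_lin S) (opp_bnd S).

Let add_lin (S T : bop) : linear (fun x => S x + T x).
Proof. by move=> a x y; rewrite !linearP scalerDr addrACA. Qed.
Let add_bnd (S T : bop) : exists c : R[i], forall x, `|S x + T x| <= c * `|x|.
Proof.
have [c hc] := bop_bounded S; have [d hd] := bop_bounded T.
by exists (c + d) => x; rewrite mulrDl (le_trans (ler_normD _ _))// lerD.
Qed.
Definition bopD S T := Bop (add_lin S T) (add_bnd S T).

Let scale_lin a (S : bop) : linear (fun x => a *: S x).
Proof. by move=> b x y; rewrite linearP scalerDr !scalerA mulrC. Qed.
Let scale_bnd a (S : bop) : exists c : R[i], forall x, `|a *: S x| <= c * `|x|.
Proof.
have [c hc] := bop_bounded S; exists (`|a| * c) => x.
by rewrite normrZ -mulrA ler_wpM2l.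
Qed.
Definition bopZ a S := Bop (scale_lin a S) (scale_bnd a S).

Let comp_lin (S T : bop) : linear (fun x => S (T x)).
Proof. by move=> a x y; rewrite !linearP. Qed.
Lemma bop_boundR (S : bop) :
  exists2 c : R, 0 <= c & forall x, `|S x| <= c%:C%C * `|x|.
Proof.
have [c hc] := bop_bounded S; exists (complex.Re `|c|).
  have := normr_ge0 c; rewrite lecE => /andP[_]; exact.
move=> x; apply: (le_trans (hc x)).
have -> : (complex.Re `|c|)%:C%C = `|c| by rewrite RRe_real// ger0_real.
have h : 0 <= c * `|x| by apply: le_trans (hc x).
rewrite -(ger0_norm h) normrM normr_id //.
Qed.
Let comp_bnd (S T : bop) : exists c : R[i], forall x, `|S (T x)| <= c * `|x|.
Proof.
have [c c0 hc] := bop_boundR S; have [d d0 hd] := bop_boundR T.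
exists (c%:C * d%:C)%C => x; rewrite (le_trans (hc _))// -mulrA ler_wpM2l//.
by rewrite ler0c.
Qed.
Definition bopM S T := Bop (comp_lin S T) (comp_bnd S T).

Let bopDA : associative bopD.
Proof. by move=> S T U; apply: bopP => x /=; rewrite addrA. Qed.
Let bopDC : commutative bopD.
Proof. by move=> S T; apply: bopP => x /=; rewrite addrC. Qed.
Let bop0D : left_id bop0 bopD.
Proof. by move=> S; apply: bopP => x /=; rewrite add0r. Qed.
Let bopND : left_inverse bop0 bopN bopD.
Proof. by move=> S; apply: bopP => x /=; rewrite addNr. Qed.
HB.instance Definition _ := GRing.isZmodule.Build bop bopDA bopDC bop0D bopND.

Let bopZA a b S : bopZ a (bopZ b S) = bopZ (a * b) S.
Proof. by apply: bopP => x /=; rewrite scalerA. Qed.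
Let bopZ1 : left_id 1 bopZ.
Proof. by move=> S; apply: bopP => x /=; rewrite scale1r. Qed.
Let bopZDr : right_distributive bopZ +%R.
Proof. by move=> a S T; apply: bopP => x /=; rewrite scalerDr. Qed.
Let bopZDl S : {morph bopZ^~ S : a b / a + b}.
Proof. by move=> a b; apply: bopP => x /=; rewrite scalerDl. Qed.
HB.instance Definition _ :=
  GRing.Zmodule_isLmodule.Build R[i] bop bopZA bopZ1 bopZDr bopZDl.

Let ReK (c : R[i]) : 0 <= c -> (complex.Re c)%:C%C = c.
Proof. by move=> c0; rewrite RRe_real// ger0_real. Qed.
Let Re_ge0 (c : R[i]) : 0 <= c -> 0 <= complex.Re c.
Proof. by rewrite lecE => /andP[]. Qed.
Let nm (x : H) : R := complex.Re `|x|.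
Let nmE (x : H) : (nm x)%:C%C = `|x|. Proof. exact: ReK. Qed.

Definition bop_norm (S : bop) : R :=
  sup [set complex.Re `|S x| | x in [set x : H | `|x| <= 1]].

Let bop_norm_has_sup (S : bop) : has_sup [set nm (S x) | x in [set x : H | `|x| <= 1]].
Proof.
split; first by exists (nm (S 0)), 0 => //=; rewrite normr0 ler01.
have [c c0 hc] := bop_boundR S; exists c => _ [x /= x1 <-].
by rewrite -lecR nmE (le_trans (hc x))// ler_piMr// ler0c.
Qed.

Lemma bop_norm_ge0 S : 0 <= bop_norm S.
Proof.
apply: le_trans (ub_le_sup (bop_norm_has_sup S).2 (x := nm (S 0)) _).
  by rewrite -ler0c nmE.
by exists 0 => //=; rewrite normr0 ler01.
Qed.

Lemma bop_normP S x : `|S x| <= (bop_norm S)%:C%C * `|x|.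
Proof.
have [->|x0] := eqVneq x 0; first by rewrite linear0 !normr0 mulr0.
have nx : 0 < `|x| by rewrite normr_gt0.
rewrite -ler_pdivrMr// mulrC -[_^-1]ger0_norm ?invr_ge0// -normrZ.
rewrite -linearZ -[leLHS]nmE lecR; apply: (ub_le_sup (bop_norm_has_sup S).2).
by exists (`|x|^-1 *: x) => //=; rewrite normrZ normfV normr_id mulVf ?gt_eqF.
Qed.

Lemma bop_norm_le S (c : R) : 0 <= c ->
  (forall x, `|S x| <= c%:C%C * `|x|) -> bop_norm S <= c.
Proof.
move=> c0 hc; apply: ge_sup; first exact: (bop_norm_has_sup S).1.
move=> _ [x /= x1 <-].
by rewrite -lecR nmE (le_trans (hc x))// ler_piMr// ler0c.
Qed.

Let norm (S : bop) : R[i] := (bop_norm S)%:C%C.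

Let norm_triangle S T : norm (S + T) <= norm S + norm T.
Proof.
rewrite /norm -[leRHS]raddfD lecR; apply: bop_norm_le => [|x].
  by rewrite addr_ge0 ?bop_norm_ge0.
rewrite raddfD mulrDl; apply: le_trans (ler_normD _ _) _.
by apply: lerD; apply: bop_normP.
Qed.

Let norm_le_scale a S : norm (a *: S) <= `|a| * norm S.
Proof.
rewrite /norm -[`|a|]ReK// -[leRHS]rmorphM lecR.
apply: bop_norm_le => [|x].
  by apply: mulr_ge0; [exact: Re_ge0 | exact: bop_norm_ge0].
rewrite rmorphM [X in X * _ * _](ReK (normr_ge0 a)) -mulrA.
rewrite [leLHS](normrZ a (S x)); apply: ler_wpM2l => //; exact: bop_normP.
Qed.

Let norm_scale a S : norm (a *: S) = `|a| * norm S.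
Proof.
apply/le_anti; rewrite norm_le_scale/=.
have [->|a0] := eqVneq a 0.
  by rewrite normr0 mul0r /norm ler0c bop_norm_ge0.
rewrite -ler_pdivlMl ?normr_gt0// -normfV.
by rewrite -{1}[S](scalerK a0) norm_le_scale.
Qed.

Let norm_eq0 S : norm S = 0 -> S = 0.
Proof.
move=> S0; apply: bopP => x /=; apply/eqP; rewrite -normr_le0.
by have := bop_normP S x; rewrite -/(norm S) S0 mul0r.
Qed.

HB.instance Definition _ :=
  Lmodule_isNormed.Build R[i] bop norm_triangle norm_scale norm_eq0.

Lemma bop_normE (S : bop) : `|S| = (bop_norm S)%:C%C. Proof. by []. Qed.

Lemma bop_norm_apply (S : bop) x : `|S x| <= `|S| * `|x|.
Proof. exact: bop_normP. Qed.

Lemma bop_norm_leC (S : bop) (c : R[i]) : 0 <= c ->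
  (forall x, `|S x| <= c * `|x|) -> `|S| <= c.
Proof.
move=> c0; have <- : (complex.Re c)%:C%C = c by rewrite RRe_real// ger0_real.
move=> hc; rewrite bop_normE lecR; apply: bop_norm_le => //.
by rewrite -ler0c RRe_real// ger0_real.
Qed.

End Bop.

Section BopComplete.
Variables (R : realType) (H : hilbertType R).
Implicit Types (S T : bop H).

Let bop_complete (F : set_system (bop H)) : ProperFilter F -> cauchy F -> cvg F.
Proof.
move=> FF /cauchyP Fc.
have {}Fc e : 0 < e -> exists S, \forall T \near F, `|S - T| < e.
  by move=> /Fc [S FS]; exists S; move: FS; rewrite -ball_normE.
have cvx x : cvg ((fun S : bop H => S x) @ F).
  apply: cauchy_cvg; apply: cauchy_exP => e e0.
  have n0 : 0 < `|x| + 1 by rewrite ltr_wpDl.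
  have [S FS] := Fc (e / (`|x| + 1)) (divr_gt0 e0 n0).
  exists (S x); rewrite -ball_normE; apply: filterS FS => T /= ST.
  have -> : S x - T x = (S - T) x by [].
  apply: le_lt_trans (bop_norm_apply _ _) _.
  rewrite -(divfK (lt0r_neq0 n0) e).
  apply: (@le_lt_trans _ _ (`|S - T| * (`|x| + 1))).
    by rewrite ler_wpM2l// lerDl.
  by rewrite ltr_pM2r.
pose g x := lim ((fun S : bop H => S x) @ F).
have gE x : bfun S x @[S --> F] --> g x by exact: cvx.
have ev (e : R[i]) : 0 < e ->
    \forall S \near F, forall x, `|bfun S x - g x| <= e * `|x|.
  move=> e0.
  have [S FS] := Fc (e / 2) (divr_gt0 e0 (ltr0Sn _ 1)).
  have hS x : `|S x - g x| <= e / 2 * `|x|.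
    apply/ler_addgt0Pr => d d0.
    have /cvgrPdist_lt/(_ d d0) Fx := gE x.
    have [T [/= ST Tx]] := filter_ex (filterI FS Fx).
    rewrite -(subrK (T x) (S x)) -addrA.
    apply: le_trans (ler_normD _ _) _; apply: lerD.
      have -> : S x - T x = (S - T) x by [].
      apply: le_trans (bop_norm_apply _ _) _.
      by rewrite ler_wpM2r// ltW.
    by rewrite distrC ltW.
  apply: filterS FS => T ST x.
  rewrite -(subrK (S x) (T x)) -addrA [e]splitr mulrDl.
  apply: le_trans (ler_normD _ _) _; apply: lerD => //.
  have -> : T x - S x = (T - S) x by [].
  apply: le_trans (bop_norm_apply _ _) _.
  by rewrite distrC ler_wpM2r// ltW.
have glin : linear g.
  move=> a x y.
  have h : (a *: bfun S x + bfun S y) @[S --> F] --> a *: g x + g y.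
    by apply: cvgD => //; apply: cvgZr.
  have h' : (a *: bfun S x + bfun S y) @[S --> F] --> g (a *: x + y).
    under eq_fun do rewrite -linearP; exact: gE.
  exact: (cvg_unique _ h' h).
have gbnd : exists c : R[i], forall x, `|g x| <= c * `|x|.
  have [S hS] := filter_ex (ev 1 ltr01).
  exists (`|S| + 1) => x; rewrite -[g x](subrK (S x)) mulrDl addrC.
  apply: le_trans (ler_normD _ _) _; apply: lerD; first exact: bop_norm_apply.
  by rewrite distrC.
apply/cvg_ex; exists (Bop glin gbnd).
apply/cvgrPdist_le => /= e e0.
apply: filterS (ev e e0) => S hS.
apply: bop_norm_leC; first exact: ltW.
by move=> x; rewrite -[leLHS]normrN opprB; exact: hS.
Qed.
HB.instance Definition _ := Uniform_isComplete.Build (bop H) bop_complete.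

End BopComplete.

Section HilbertTheory.
Variables (R : realType) (H : hilbertType R).
Local Notation C := R[i].
Local Notation "''[' u , v ]" := (hdot H u v) : ring_scope.

Lemma hdotC (x y : H) : '[x, y] = '[y, x]^*.
Proof. by rewrite [LHS]hermitian_subproof expr0 mul1r. Qed.

Lemma hdotDl (x y z : H) : '[x + y, z] = '[x, z] + '[y, z].
Proof. exact: linearDl. Qed.
Lemma hdotDr (x y z : H) : '[z, x + y] = '[z, x] + '[z, y].
Proof. exact: linearDr. Qed.
Lemma hdotBl (x y z : H) : '[x - y, z] = '[x, z] - '[y, z].
Proof. exact: linearBl. Qed.
Lemma hdotBr (x y z : H) : '[z, x - y] = '[z, x] - '[z, y].
Proof. exact: linearBr. Qed.
Lemma hdotZl a (x y : H) : '[a *: x, y] = a * '[x, y].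
Proof. exact: linearZl_LR. Qed.
Lemma hdotZr a (x y : H) : '[x, a *: y] = a^* * '[x, y].
Proof. exact: linearZr_LR. Qed.

Lemma hdot_proj (x z : H) : z != 0 ->
  let w := x - ('[x, z] / '[z, z]) *: z in
  '[x, x] = '[w, w] + `|'[x, z]| ^+ 2 / '[z, z].
Proof.
move=> z0 w; set c := '[x, z] / '[z, z].
have nz : '[z, z] != 0 by rewrite -hdotE expf_neq0// normr_eq0.
have zr : '[z, z]^* = '[z, z] by rewrite -hdotC.
have wz : '[w, z] = 0 by rewrite hdotBl hdotZl divfK// subrr.
have zw : '[z, w] = 0 by rewrite hdotC wz conjC0.
have xE : x = w + c *: z by rewrite subrK.
clearbody w.
rewrite {1 2}xE !(hdotDl, hdotDr, hdotZl, hdotZr) wz zw !(mulr0, addr0, add0r).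
congr (_ + _); rewrite normCK /c rmorphM fmorphV/= zr.
by field.
Qed.

Lemma hdot_CauchySchwarz (x y : H) : `|'[x, y]| <= `|x| * `|y|.
Proof.
have [->|y0] := eqVneq y 0.
  by rewrite normr0 mulr0 (linear0r (hdot H)) normr0.
have ny : 0 < '[y, y] by rewrite -hdotE exprn_gt0// normr_gt0.
rewrite -(@ler_pXn2r _ 2%N)// ?nnegrE ?mulr_ge0//.
rewrite exprMn !hdotE (hdot_proj x y0) mulrDl divfK ?gt_eqF//.
by rewrite lerDr mulr_ge0// -hdotE exprn_ge0.
Qed.

Lemma hdot_inj (y z : H) : (forall x, '[x, y] = '[x, z]) -> y = z.
Proof.
move=> yz; apply/eqP; rewrite -subr_eq0 -normr_eq0 -sqrf_eq0 hdotE.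
by rewrite hdotBr yz subrr.
Qed.

Lemma parallelogram (x y : H) :
  `|x - y| ^+ 2 = `|x| ^+ 2 *+ 2 + `|y| ^+ 2 *+ 2 - `|x + y| ^+ 2.
Proof.
rewrite !hdotE !(hdotDl, hdotDr) !(linearNl (hdot H)) !(linearNr (hdot H)).
by ring.
Qed.

Let ReK (c : C) : 0 <= c -> (complex.Re c)%:C%C = c.
Proof. by move=> c0; rewrite RRe_real// ger0_real. Qed.

Let ltr0c (k : R) : (0 < k%:C%C :> C) = (0 < k).
Proof. exact: (ltcR 0 k). Qed.

Lemma Riesz_representation (f : H -> C) : linear_for *%R f ->
  (exists c : C, forall x, `|f x| <= c * `|x|) -> exists y, forall x, f x = '[x, y].
Proof.
move=> flin [c fc].
have fD x y : f (x + y) = f x + f y.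
  by have := flin 1 x y; rewrite scale1r mul1r.
have f0 : f 0 = 0 by apply: (addrI (f 0)); rewrite -fD !addr0.
have fZ a x : f (a *: x) = a * f x by have := flin a x 0; rewrite f0 !addr0.
have fN x : f (- x) = - f x by rewrite -scaleN1r fZ mulN1r.
have [fz|] := pselect (forall x, f x = 0).
  by exists 0 => x; rewrite fz (linear0r (hdot H)).
move=> /existsNP[x1 /eqP fx1].
pose q (x : H) : R := complex.Re (`|x| ^+ 2).
have qE x : (q x)%:C%C = `|x| ^+ 2 by rewrite ReK// exprn_ge0.
have q0 x : 0 <= q x by rewrite -ler0c qE exprn_ge0.
pose E := [set q x | x in [set x | f x = 1]].
have Einf : has_inf E.
  split; last by exists 0 => _ [x _ <-].
  by exists (q ((f x1)^-1 *: x1)), ((f x1)^-1 *: x1) => //=; rewrite fZ mulVf.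
pose d := inf E.
have dq x : f x = 1 -> d <= q x by move=> fx; apply: (ge_inf Einf.2); exists x.
pose A (e : R) := [set x | f x = 1 /\ q x < d + e].
pose F := filter_from [set e : R | 0 < e] A.
have A0 e : 0 < e -> A e !=set0.
  by move=> e0; have [_ [x fx <-] qx] := inf_adherent e0 Einf; exists x.
have FF : ProperFilter F.
  apply: filter_from_proper; last by move=> e; exact: A0.
  apply: filter_from_filter; first by exists 1 => /=.
  move=> e1 e2 /= e10 e20; exists (Num.min e1 e2); first by rewrite lt_min e10.
  by move=> x [fx qx]; split; split=> //; apply: (lt_le_trans qx);
    rewrite lerD2l ge_min lexx ?orbT.
have AF e : 0 < e -> F (A e) by move=> e0; exists e.
have [x0 Fx0] : exists x0 : H, F --> x0.
  apply/cvg_ex; apply: cauchy_cvg; apply: cauchy_exP => e e0.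
  pose e' := complex.Re (e ^+ 2) / 8.
  have e'E : (e' *+ 8)%:C%C = e ^+ 2.
    by rewrite /e' -mulr_natr divfK// ReK// exprn_ge0// ltW.
  have e'0 : 0 < e'.
    have : 0 < (e' *+ 8)%:C%C by rewrite e'E exprn_gt0.
    by rewrite ltr0c pmulrn_lgt0.
  have [x [fx qx]] := A0 _ e'0; exists x.
  rewrite -ball_normE; apply: filterS (AF _ e'0) => y [fy qy] /=.
  rewrite -(@ltr_pXn2r _ 2%N)// ?nnegrE ?(ltW e0)// parallelogram -e'E.
  have dxy : d *+ 4 <= q (x + y).
    have -> : q (x + y) = q (2^-1 *: (x + y)) *+ 4.
      apply: complexI; rewrite raddfMn/= !qE normrZ exprMn ger0_norm ?invr_ge0//.
      by field.
    rewrite lerMn2r /= dq// fZ fD fx fy.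
    by field.
  rewrite -!qE -!raddfMn -!raddfD -raddfB ltcR.
  by rewrite ltrBlDr; lra.
have near_x0 (e : R) (eta : C) : 0 < e -> 0 < eta ->
    exists x, [/\ f x = 1, q x < d + e & `|x0 - x| < eta].
  move=> e0 eta0.
  have Fx := Fx0 _ (nbhsx_ballx x0 _ eta0); rewrite -ball_normE in Fx.
  by have [x [[fx qx] xx]] := filter_ex (filterI (AF e e0) Fx); exists x.
have c0 : 0 <= c.
  have nx1 : 0 < `|x1|.
    by rewrite normr_gt0; apply: contra fx1 => /eqP->; rewrite f0.
  by rewrite -(pmulr_lge0 _ nx1); apply: le_trans (fc x1).
have fx0 : f x0 = 1.
  apply/eqP; rewrite -subr_eq0 -normr_le0; apply/ler_addgt0Pr => e e0.
  have c1 : 0 < c + 1 by rewrite ltr_wpDl.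
  have [x [fx _ xx]] := near_x0 1 (e / (c + 1)) ltr01 (divr_gt0 e0 c1).
  rewrite -fx -fN -fD add0r; apply: (le_trans (fc _)).
  rewrite -(divfK (lt0r_neq0 c1) e) mulrC.
  apply: ler_pM => //; first exact: ltW.
  by rewrite lerDl.
have orth z : f z = 0 -> '[x0, z] = 0.
  move=> fz; have [->|z0] := eqVneq z 0; first exact: (linear0r (hdot H)).
  have nz : 0 < `|z| by rewrite normr_gt0.
  apply/eqP; rewrite -normr_le0; apply/ler_addgt0Pr => eta eta0.
  pose h := eta / 2 / `|z|.
  have h0 : 0 < h by rewrite !divr_gt0.
  have eE : (complex.Re (h ^+ 2))%:C%C = h ^+ 2 by rewrite ReK// exprn_ge0// ltW.
  have e0 : 0 < complex.Re (h ^+ 2) by rewrite -ltr0c eE exprn_gt0.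
  have [x [fx qx xx]] := near_x0 _ _ e0 h0.
  have xz : `|'[x, z]| <= eta / 2.
    have zz : 0 < '[z, z] by rewrite -hdotE exprn_gt0.
    have := hdot_proj x z0; set w := x - _ => /= xw.
    have dw : d <= q w by rewrite dq// fD fN fZ fz mulr0 subr0.
    rewrite -(@ler_pXn2r _ 2%N)// ?nnegrE ?divr_ge0 ?(ltW eta0)//.
    have -> : (eta / 2) ^+ 2 = h ^+ 2 * '[z, z].
      by rewrite -hdotE -exprMn divfK ?gt_eqF.
    rewrite -ler_pdivrMr// -(lerD2l '[w, w]) -xw -!hdotE -!qE -eE -raddfD lecR.
    by apply/ltW/(lt_le_trans qx); rewrite lerD2r.
  rewrite add0r -[x0](subrK x) hdotDl addrC [eta]splitr.
  apply: le_trans (ler_normD _ _) _; apply: lerD => //.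
  apply: le_trans (hdot_CauchySchwarz _ _) _.
  by rewrite -(divfK (lt0r_neq0 nz) (eta / 2)) ler_pM2r// ltW.
have x00 : '[x0, x0] != 0.
  rewrite -hdotE expf_neq0// normr_eq0; apply/eqP => x0E.
  by move: fx0; rewrite x0E f0 => /eqP; rewrite eq_sym oner_eq0.
have r00 : '[x0, x0]^* = '[x0, x0] by rewrite -hdotC.
exists ('[x0, x0]^-1 *: x0) => x.
have /orth : f (x - f x *: x0) = 0 by rewrite fD fN fZ fx0 mulr1 subrr.
rewrite hdotBr hdotZr => /subr0_eq xx0.
have {}xx0 : '[x, x0] = f x * '[x0, x0].
  by rewrite hdotC xx0 rmorphM/= conjCK r00.
by rewrite hdotZr fmorphV/= r00 xx0 mulrC mulfK.
Qed.

Lemma bop_adjoint_ex (S : bop H) :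
  exists T : bop H, forall x y, '[S x, y] = '[x, T y].
Proof.
have ex y : exists z, forall x, '[S x, y] = '[x, z].
  apply: Riesz_representation => [a u v|].
    by rewrite linearP hdotDl hdotZl.
  exists (`|S| * `|y|) => x; apply: le_trans (hdot_CauchySchwarz _ _) _.
  by rewrite mulrAC ler_wpM2r// bop_norm_apply.
pose T y := projT1 (cid (ex y)).
have TE x y : '[S x, y] = '[x, T y] by rewrite /T; case: cid.
have Tlin : linear T.
  move=> a u v; apply: hdot_inj => x.
  by rewrite -TE !(hdotDr, hdotZr) -!TE.
have Tbnd : exists c : R[i], forall x, `|T x| <= c * `|x|.
  exists `|S| => y; have [->|Ty] := eqVneq (T y) 0.
    by rewrite normr0 mulr_ge0.
  have nTy : 0 < `|T y| by rewrite normr_gt0.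
  rewrite -(ler_pM2l nTy) -expr2 hdotE -TE mulrA [X in X * _]mulrC.
  rewrite -['[_, _]]ger0_norm; last by rewrite TE -hdotE exprn_ge0.
  apply: le_trans (hdot_CauchySchwarz _ _) _.
  by rewrite ler_wpM2r// bop_norm_apply.
by exists (Bop Tlin Tbnd).
Qed.

Definition adjoint (S : bop H) : bop H := projT1 (cid (bop_adjoint_ex S)).

Lemma adjointP (S : bop H) x y : '[S x, y] = '[x, adjoint S y].
Proof. by rewrite /adjoint; case: cid. Qed.

Lemma adjoint_uniq (S T : bop H) :
  (forall x y, '[S x, y] = '[x, T y]) -> adjoint S = T.
Proof.
by move=> h; apply: bopP => y; apply: hdot_inj => x; rewrite -adjointP.
Qed.

Let bopM_bilin : bilinear_for
  (GRing.Scale.Law.clone _ _ *:%R _) (GRing.Scale.Law.clone _ _ *:%R _)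
  (@bopM R H).
Proof.
split=> [U a S T|U a S T] /=; apply: bopP => x //=.
by rewrite linearP.
Qed.
HB.instance Definition _ := bilinear_isBilinear.Build R[i] (bop H) (bop H) (bop H)
  _ _ (@bopM R H) bopM_bilin.

Let bopMA : associative (@bopM R H). Proof. by move=> S T U; apply: bopP. Qed.

Let bop_normM (S T : bop H) : `|bopM S T| <= `|S| * `|T|.
Proof.
apply: bop_norm_leC => [|x]; first by rewrite mulr_ge0.
apply: (le_trans (bop_norm_apply S (T x))).
by rewrite -mulrA ler_wpM2l// bop_norm_apply.
Qed.

Let adjointL a S T : adjoint (a *: S + T) = a^* *: adjoint S + adjoint T.
Proof.
apply: adjoint_uniq => x y; rewrite hdotDl hdotDr hdotZl hdotZr conjCK.
by rewrite !adjointP.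
Qed.

Let adjointK : involutive adjoint.
Proof. by move=> S; apply: adjoint_uniq => x y; rewrite hdotC -adjointP -hdotC. Qed.

Let adjointM S T : adjoint (bopM S T) = bopM (adjoint T) (adjoint S).
Proof. by apply: adjoint_uniq => x y /=; rewrite !adjointP. Qed.

Let adjoint_norm_le S : `|S| ^+ 2 <= `|bopM (adjoint S) S|.
Proof.
set c := `|bopM _ _|; have c0 : 0 <= c by exact: normr_ge0.
have sc0 : 0 <= sqrtC c by rewrite sqrtC_ge0.
rewrite -[leRHS]sqrtCK ler_pXn2r ?nnegrE ?sqrtC_ge0//.
apply: bop_norm_leC => // x.
rewrite -(@ler_pXn2r _ 2%N) ?nnegrE ?mulr_ge0//.
rewrite exprMn sqrtCK hdotE adjointP.
rewrite -['[_, _]]ger0_norm; last by rewrite -adjointP -hdotE exprn_ge0.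
apply: le_trans (hdot_CauchySchwarz _ _) _.
by rewrite mulrC expr2 mulrA ler_wpM2r// (bop_norm_apply (bopM _ _)).
Qed.

Let adjoint_norm_ge S : `|S| <= `|adjoint S|.
Proof.
have [->|S0] := eqVneq `|S| 0; first by [].
have nS : 0 < `|S| by rewrite lt_neqAle eq_sym S0 normr_ge0.
rewrite -(ler_pM2r nS) -expr2.
exact: le_trans (adjoint_norm_le S) (bop_normM _ _).
Qed.

Let bop_normCstar S : `|bopM (adjoint S) S| = `|S| ^+ 2.
Proof.
apply/le_anti; rewrite adjoint_norm_le andbT expr2.
apply: le_trans (bop_normM _ _) _; rewrite ler_wpM2r//.
by rewrite -{2}[S]adjointK adjoint_norm_ge.
Qed.

Definition BH : cstarAlgType R :=
  @CstarAlg R (bop H) (@bopM R H) adjoint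
    bopMA bop_normM adjointL adjointK adjointM bop_normCstar.

End HilbertTheory.

Section CstarNotions.
Variable R : realType.

Definition partial_isometry (B : cstarAlgType R) (x : B) : Prop :=
  x *c cstar x *c x = x.

Definition star_subalgebra (B : cstarAlgType R) (X : set B) : Prop :=
  [/\ X 0, (forall (a : R[i]) x y, X x -> X y -> X (a *: x + y)),
      (forall x y, X x -> X y -> X (x *c y)) & (forall x, X x -> X (cstar x))].

Definition cstar_generated (B : cstarAlgType R) (G : set B) : set B :=
  smallest (fun X => closed X /\ star_subalgebra X) G.

Definition star_hom (B1 B2 : cstarAlgType R) (phi : B1 -> B2) : Prop :=
  [/\ linear phi, (forall x y, phi (x *c y) = phi x *c phi y) &
      (forall x, phi (cstar x) = cstar (phi x))].

Definition star_iso_onto (B1 B2 : cstarAlgType R) (phi : B1 -> B2)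
    (X : set B2) : Prop :=
  [/\ star_hom phi, injective phi & range phi = X].

End CstarNotions.

Section Words.
Variables (r : nat) (A : finType) (M : 'I_r -> A -> A -> int).

(* M j b a is the entry M_j(b, a). *)

Definition zle (m n : 'rV[int]_r) : bool := [forall i, m 0 i <= n 0 i].

Definition box (m n : 'rV[int]_r) : pred 'rV[int]_r :=
  [pred k | zle m k && zle k n].

(* A word of shape m is a map on [0, m]; it is encoded as a partial function
   on Z^r with domain exactly [0, m], so that Leibniz equality of words is
   equality of shapes and of maps. *)
Record word := Word {
  wshape : 'rV[int]_r;
  wmap : 'rV[int]_r -> option A;
  wshape_ge0 : zle 0 wshape;
  wmap_dom : forall l, isSome (wmap l) = box 0 wshape l;
  wmap_adm : forall l j a b,
    wmap l = Some a -> wmap (l + delta_mx 0 j) = Some b -> M j b a = 1 }.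

Lemma wordP (u v : word) : wshape u = wshape v -> wmap u =1 wmap v -> u = v.
Proof.
case: u v => m f m0 fd fa [n g n0 gd ga] /= mn /funext fg; subst n g.
congr Word; exact: Prop_irrelevance.
Qed.

HB.instance Definition _ := gen_eqMixin word.
HB.instance Definition _ := gen_choiceMixin word.

(* always of the form Some a *)
Definition origin (w : word) : option A := wmap w 0.
Definition terminus (w : word) : option A := wmap w (wshape w).

Definition wrestrict (w : word) (k l : 'rV[int]_r) : 'rV[int]_r -> option A :=
  fun i => if box 0 (l - k) i then wmap w (i + k) else None.

Definition periodic (p : 'rV[int]_r) (w : word) : Prop :=
  forall j, box 0 (wshape w) j -> box p (p + wshape w) j ->
    wmap w j = wmap w (j - p).

Definition is_product (u v w : word) : Prop :=
  [/\ wshape w = wshape u + wshape v,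
      wrestrict w 0 (wshape u) =1 wmap u &
      wrestrict w (wshape u) (wshape u + wshape v) =1 wmap v].

(* the product u v, with the dummy value u when there is no product *)
Definition wprod (u v : word) : word := xget u [set w | is_product u v w].

Record admissible : Prop := Admissible {
  admissible_H0 : forall j,
    (forall b a, M j b a \in [:: 0; 1]) /\ (exists b a, M j b a != 0);
  admissible_H1 : forall u v, terminus u = origin v ->
    exists! w, is_product u v w;
  admissible_H2 : forall a b,
    connect [rel x y | [exists j, M j y x == 1]] a b;
  admissible_H3 : forall p, p != 0 -> exists w, ~ periodic p w }.

Lemma origin_wprod (u v : word) : origin (wprod u v) = origin u.
Proof.
rewrite /wprod; case: xgetP => [w _ [_ /(_ 0) wu _]|//].
have b0 : box 0 (wshape u) 0.
  by rewrite /box/= wshape_ge0 andbT; apply/forallP => i.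
by rewrite /origin -wu /wrestrict subr0 b0 addr0.
Qed.

Lemma finite_words_e j : finite_set [set w : word | wshape w = delta_mx 0 j].
Proof.
pose g (w : word) : option A * option A := (wmap w 0, wmap w (delta_mx 0 j)).
set W := (X in finite_set X).
have g_inj : {in W &, injective g}.
  move=> u v; rewrite !inE /W /= => uj vj [g0 ge].
  apply: wordP => [|l]; first by rewrite uj vj.
  have [lb|lb] := boolP (box 0 (delta_mx 0 j) l); last first.
    have := wmap_dom u l; have := wmap_dom v l; rewrite uj vj (negbTE lb).
    by case: (wmap u l) (wmap v l) => [?|] [?|].
  case/andP: lb => /forallP l0 /forallP l1.
  suff [->|->] : l = 0 \/ l = delta_mx 0 j by [].
  have lE i : i != j -> l 0 i = 0.
    move=> ij; have := l0 i; have := l1 i; rewrite !mxE/= (negbTE ij) => h1 h2.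
    by apply/le_anti; rewrite h1 h2.
  have : l 0 j = 0 \/ l 0 j = 1.
    have := l0 j; have := l1 j; rewrite !mxE/= eqxx.
    by case: (l 0 j) => [[|[|n]]|n] //; [left|right].
  case=> lj; [left|right]; apply/rowP => i; rewrite !mxE/=;
    by have [->|/lE->] := eqVneq i j.
by rewrite -(eq_finite_set (inj_card_eq g_inj)).
Qed.

End Words.

Section Decorated.
Variables (r : nat) (A : finType) (M : 'I_r -> A -> A -> int).
Variables (D : Type) (delta : D -> A).

Record dword := DWord {
  deco : D;
  dbase : word M;
  dword_compat : origin dbase = Some (delta deco) }.

Definition dterminus (u : dword) : option A := terminus (dbase u).
Definition dshape (u : dword) : 'rV[int]_r := wshape (dbase u).

Definition dprod (u : dword) (v : word M) : dword :=
  @DWord (deco u) (wprod (dbase u) v)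
    (etrans (origin_wprod (dbase u) v) (dword_compat u)).

Variables (R : realType) (B : cstarAlgType R).

(* Generators are indexed by the pairs (u, v) with t(u) = t(v); the values of
   a family s at other pairs are irrelevant and never referred to. *)
Record defining_relations (s : dword -> dword -> B) : Prop :=
  DefiningRelations {
  rel_star : forall u v, dterminus u = dterminus v -> cstar (s u v) = s v u;
  rel_mul : forall u v w, dterminus u = dterminus v ->
    dterminus v = dterminus w -> s u v *c s v w = s u w;
  rel_sum : forall j u v, dterminus u = dterminus v ->
    s u v = \sum_(w \in [set w : word M |
              wshape w = delta_mx 0 j /\ origin w = dterminus u])
              s (dprod u w) (dprod v w);
  rel_orth : forall u v, dshape u = 0 -> dshape v = 0 -> u <> v ->
    s u u *c s v v = 0 }.

Definition partial_isometries (s : dword -> dword -> B) : Prop :=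
  forall u v, dterminus u = dterminus v -> partial_isometry (s u v).

Definition generators (s : dword -> dword -> B) : set B :=
  [set x | exists u v, dterminus u = dterminus v /\ x = s u v].

End Decorated.

(* cA, together with the family s, is the universal C*-algebra generated by
   partial isometries subject to the defining relations. *)
Record is_universal_algebra (r : nat) (A : finType) (M : 'I_r -> A -> A -> int)
    (D : Type) (delta : D -> A) (R : realType) (cA : cstarAlgType R)
    (s : dword M delta -> dword M delta -> cA) : Prop := IsUniversalAlgebra {
  univ_partial_isometries : partial_isometries s;
  univ_relations : defining_relations s;
  univ_generated : cstar_generated (generators s) = setT;
  univ_map : forall (B : cstarAlgType R) (t : dword M delta -> dword M delta -> B),
    partial_isometries t -> defining_relations t ->
    exists! phi : cA -> B, star_hom phi /\
      (forall u v, dterminus u = dterminus v -> phi (s u v) = t u v) }.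

(* Main.v *)
From HB Require Import structures.
Require Import Defs.
From mathcomp Require Import all_boot all_order all_algebra.
From mathcomp Require Import sesquilinear.
From mathcomp Require Import complex.
From mathcomp Require Import all_classical all_reals all_analysis.
From mathcomp Require Import ring lra zify.

(** The universal property yields the *-homomorphism [phi]; it has to be shown
    isometric. On a finite linear combination [y] of the generators, let [y_d]
    be the part spanned by the [s_{u,v}] with [sigma(u) - sigma(v) = d]. After
    refining with the third relation, all [u] occurring in [y] have the same
    shape. By (H2) and (H3) every letter [a] is the origin of a word [w_a] that
    is not [p]-periodic for any of the finitely many differences [p] of degrees;
    compressing [phi y] by the projections onto the words [u w_a] and [v w_a]
    therefore leaves only the degree [d] part, and it acts there through nonzero
    matrix units. Hence [|y_d| <= |phi y|]. As [(y^* y)^N], [N = 2^k], has only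
    polynomially many homogeneous parts in [N], the C*-identity
    [|h^N| = |h|^N] removes the multiplicity and gives [|y| <= |phi y|].
    The products of formal sums used here rest on the fact that projections in
    a C*-algebra whose sum is a projection are orthogonal. *)

Set Implicit Arguments.
Unset Strict Implicit.
Unset Printing Implicit Defensive.

Import Order.TTheory GRing.Theory Num.Theory.
Import numFieldNormedType.Exports.

Local Open Scope classical_set_scope.
Local Open Scope ring_scope.

(** * Real-valued norms *)

(** The fourth relation makes only words of shape 0 orthogonal. For longer words orthogonality has
    to be extracted from the third relation, which writes a projection as a sum of projections; this
    is why square roots and positivity precede the words. As one word may extend another, generators
    multiply like matrix units only when the inner indices have one shape, so every product of
    formal sums is preceded by a refinement. Refinements and products are built from words alone and
    are valid for every family satisfying the relations; the two families are thus compared on one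
    and the same formal sum. The resulting estimate holds between any two families of which the
    second never vanishes, and a bound with a factor for the number of parts suffices because this
    factor grows more slowly than any exponential. *)

Section RealNorm.
Variables (R : realType) (V : normedModType R[i]).
Implicit Types x y z : V.

Definition nrm x : R := complex.Re `|x|.

Lemma nrmE x : (nrm x)%:C%C = `|x|.
Proof. by rewrite /nrm RRe_real// ger0_real. Qed.

Lemma nrm_ge0 x : 0 <= nrm x.
Proof. by rewrite -ler0c nrmE. Qed.

Lemma nrm0 : nrm (0 : V) = 0.
Proof. by rewrite /nrm normr0. Qed.

Lemma nrm_le0 x : nrm x <= 0 -> x = 0.
Proof. by rewrite -lecR nrmE normr_le0 => /eqP. Qed.

Lemma nrmD x y : nrm (x + y) <= nrm x + nrm y.
Proof. by rewrite -lecR rmorphD /= !nrmE ler_normD. Qed.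

Lemma nrmN x : nrm (- x) = nrm x.
Proof. by rewrite /nrm normrN. Qed.

Lemma nrmB x y : nrm (x - y) <= nrm x + nrm y.
Proof. by rewrite -[nrm y]nrmN nrmD. Qed.

Lemma nrm_distC x y : nrm (x - y) = nrm (y - x).
Proof. by rewrite -nrmN opprB. Qed.

Lemma nrm_tri z x y : nrm (x - y) <= nrm (x - z) + nrm (z - y).
Proof. by rewrite -{1}(subrK z x) -addrA nrmD. Qed.

Lemma nrmZ (a : R[i]) x : nrm (a *: x) = complex.Re `|a| * nrm x.
Proof.
apply: complexI; rewrite rmorphM /= !nrmE normrZ; congr (_ * _).
Qed.

Lemma nrmZr (a : R) x : nrm (a%:C%C *: x) = `|a| * nrm x.
Proof. by rewrite nrmZ normc_def /= expr0n addr0 sqrtr_sqr. Qed.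

Lemma nrm_sum (I : Type) (r : seq I) (P : pred I) (F : I -> V) :
  nrm (\sum_(i <- r | P i) F i) <= \sum_(i <- r | P i) nrm (F i).
Proof.
elim/big_rec2 : _ => [|i y x _ h]; first by rewrite nrm0.
by apply: le_trans (nrmD _ _) _; rewrite lerD2l.
Qed.

Lemma nrm_eps x : (forall e : R, 0 < e -> nrm x <= e) -> x = 0.
Proof. by move=> h; apply: nrm_le0; apply/ler_addgt0Pr => e e0; rewrite add0r h. Qed.

Lemma closed_limit (X : set V) l : closed X ->
  (forall e : R, 0 < e -> exists2 x, X x & nrm (l - x) < e) -> X l.
Proof.
move=> clX h; apply: clX => U /nbhs_ballP[e /= e0 eU].
have eR : (complex.Re e)%:C%C = e by rewrite RRe_real// ger0_real// ltW.
have e0' : 0 < complex.Re e by rewrite -ltcR eR.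
have [x Xx lx] := h _ e0'; exists x; split=> //; apply: eU.
by rewrite -ball_normE /= -nrmE -eR ltcR.
Qed.

Lemma closure_nrm (X : set V) l :
  closure X l <-> forall e : R, 0 < e -> exists2 x, X x & nrm (l - x) < e.
Proof.
split=> [cl e e0|h]; last first.
  by apply: (closed_limit (@closed_closure _ X)) => e /h[x Xx lx]; exists x => //;
    exact: subset_closure.
have /cl[x [Xx]] : nbhs l (ball l e%:C%C) by apply: nbhsx_ballx; rewrite ltcR.
by rewrite -ball_normE /= -nrmE ltcR => lx; exists x.
Qed.

End RealNorm.

Lemma complete_nrm (R : realType) (V : completeNormedModType R[i]) (u : nat -> V) :
  (forall e : R, 0 < e -> exists N, forall n, (N <= n)%N -> nrm (u N - u n) < e) ->
  exists l, forall e : R, 0 < e -> exists N, forall n, (N <= n)%N -> nrm (l - u n) < e.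
Proof.
move=> cu; have /cauchy_cvg uc : cauchy (u @ \oo).
  apply: cauchy_exP => e e0.
  have eR : (complex.Re e)%:C%C = e by rewrite RRe_real// ger0_real// ltW.
  have e0' : 0 < complex.Re e by rewrite -ltcR eR.
  have [N hN] := cu _ e0'; exists (u N); exists N => // n /= Nn.
  by rewrite -ball_normE /= -nrmE -eR ltcR hN.
exists (lim (u @ \oo)) => e e0.
have /cvgrPdist_lt/(_ e%:C%C) : u @ \oo --> lim (u @ \oo) by exact: uc.
rewrite ltcR => /(_ e0) [N _ hN]; exists N => n Nn.
by rewrite -ltcR nrmE; exact: hN.
Qed.

Lemma expr_lt_eps (R : realType) (q e : R) : 0 <= q < 1 -> 0 < e ->
  exists N, forall n, (N <= n)%N -> q ^+ n < e.
Proof.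
move=> /andP[q0 q1] e0.
have : `|q| < 1 by rewrite ger0_norm.
move=> /cvg_expr /cvgrPdist_lt /(_ e e0)[N _ hN].
exists N => n /hN /=; by rewrite sub0r normrN ger0_norm ?exprn_ge0.
Qed.

(** * C*-algebras *)

Section CstarTheory.
Variables (R : realType) (B : cstarAlgType R).
Local Notation C := R[i].
Implicit Types x y z : B.

Lemma cmulDl x y z : (x + y) *c z = x *c z + y *c z.
Proof. exact: linearDl. Qed.
Lemma cmulDr x y z : z *c (x + y) = z *c x + z *c y.
Proof. exact: linearDr. Qed.
Lemma cmulBl x y z : (x - y) *c z = x *c z - y *c z.
Proof. exact: linearBl. Qed.
Lemma cmulBr x y z : z *c (x - y) = z *c x - z *c y.
Proof. exact: linearBr. Qed.
Lemma cmul0l z : 0 *c z = 0 :> B.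
Proof. exact: linear0l. Qed.
Lemma cmul0r z : z *c 0 = 0 :> B.
Proof. exact: linear0r. Qed.
Lemma cmulZl (a : C) x z : (a *: x) *c z = a *: (x *c z).
Proof. exact: linearZl_LR. Qed.
Lemma cmulZr (a : C) x z : z *c (a *: x) = a *: (z *c x).
Proof. exact: linearZr_LR. Qed.

Lemma cmul_suml (I : Type) (r : seq I) (P : pred I) (F : I -> B) z :
  (\sum_(i <- r | P i) F i) *c z = \sum_(i <- r | P i) F i *c z.
Proof. exact: (big_morph (fun x => x *c z) (fun x y => cmulDl x y z) (cmul0l z)). Qed.

Lemma cmul_sumr (I : Type) (r : seq I) (P : pred I) (F : I -> B) z :
  z *c (\sum_(i <- r | P i) F i) = \sum_(i <- r | P i) z *c F i.
Proof. exact: (big_morph (fun x => z *c x) (fun x y => cmulDr x y z) (cmul0r z)). Qed.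

Lemma cstarD x y : cstar (x + y) = cstar x + cstar y.
Proof. by have := cstarL 1 x y; rewrite !scale1r conjC1 scale1r. Qed.
Lemma cstar0 : cstar (0 : B) = 0.
Proof. by apply: (addrI (cstar 0)); rewrite -cstarD !addr0. Qed.
Lemma cstarZ (a : C) x : cstar (a *: x) = a^* *: cstar x.
Proof. by have := cstarL a x 0; rewrite cstar0 !addr0. Qed.
Lemma cstarN x : cstar (- x) = - cstar x.
Proof. by apply: (addrI (cstar x)); rewrite -cstarD !subrr cstar0. Qed.
Lemma cstarB x y : cstar (x - y) = cstar x - cstar y.
Proof. by rewrite cstarD cstarN. Qed.
Lemma cstar_sum (I : Type) (r : seq I) (P : pred I) (F : I -> B) :
  cstar (\sum_(i <- r | P i) F i) = \sum_(i <- r | P i) cstar (F i).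
Proof. exact: (big_morph _ cstarD cstar0). Qed.

Lemma nrmM x y : nrm (x *c y) <= nrm x * nrm y.
Proof. by rewrite -lecR rmorphM /= !nrmE cnormM. Qed.

Lemma nrmMstar x : nrm (cstar x *c x) = nrm x ^+ 2.
Proof. by apply: complexI; rewrite rmorphXn /= !nrmE cnormCstar. Qed.

Lemma nrm_cstar x : nrm (cstar x) = nrm x.
Proof.
have le y : nrm y <= nrm (cstar y).
  have [y0|y0] := leP (nrm y) 0; first by apply: le_trans (nrm_ge0 _).
  by rewrite -(ler_pM2r y0) -expr2 -nrmMstar nrmM.
by apply/le_anti; rewrite le -{2}(cstarK x) le.
Qed.

Definition sq x := x *c x.

Lemma cstar_sq x : cstar (sq x) = sq (cstar x).
Proof. exact: cstarM. Qed.

Lemma iter_sq_star n x : cstar x = x -> cstar (iter n sq x) = iter n sq x.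
Proof. by move=> xs; elim: n => //= n IH; rewrite cstar_sq IH. Qed.

Lemma nrm_iter_sq n x : cstar x = x -> nrm (iter n sq x) = nrm x ^+ (2 ^ n).
Proof.
move=> xs; elim: n => [|n IH]; first by rewrite expr1.
by rewrite iterS /sq -{1}iter_sq_star// nrmMstar IH -exprM -expnSr.
Qed.

Lemma nrm_iter_sq_le n x : nrm (iter n sq x) <= nrm x ^+ (2 ^ n).
Proof.
elim: n => [|n IH]; first by rewrite expr1.
rewrite iterS expnSr exprM; apply: le_trans (nrmM _ _) _.
by rewrite expr2 ler_pM ?nrm_ge0.
Qed.

Definition projection x := cstar x = x /\ x *c x = x.

Lemma nrm_projection x : projection x -> nrm x = 0 \/ nrm x = 1.
Proof.
move=> [xs xx]; have := nrmMstar x; rewrite xs xx => /eqP.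
rewrite -subr_eq0 expr2 -{1}[nrm x]mulr1 -mulrBr mulf_eq0 => /orP[/eqP|];
  first by left.
by rewrite subr_eq0 => /eqP; right.
Qed.

Lemma nrm_projection_le x : projection x -> nrm x <= 1.
Proof. by case/nrm_projection => ->. Qed.

Local Notation half := (2^-1 : R)%:C%C.

Lemma half_half x : half *: x + half *: x = x.
Proof.
rewrite -scalerDl -rmorphD /= (_ : 2^-1 + 2^-1 = 1 :> R) ?scale1r//.
by lra.
Qed.

(* [k] is [1 - sqrt (1 - b)], obtained as the limit of [k := (b + k^2) / 2]
   started at 0; the last clause lets one transfer closed properties to it. *)
Lemma sqrt_fixpoint b : nrm b < 1 -> exists k, k + k = b + k *c k /\
  forall X : set B, closed X -> X 0 ->
    (forall x, X x -> X (half *: (b + x *c x))) -> X k.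
Proof.
move=> b1; set q := nrm b; have q0 : 0 <= q := nrm_ge0 b.
pose f x := half *: (b + x *c x); pose u n := iter n f 0.
have h2 : `|(2^-1 : R)| = 2^-1 by rewrite ger0_norm// invr_ge0.
have uq n : nrm (u n) <= q.
  elim: n => [|n IH]; first by rewrite /u /= nrm0.
  rewrite /u iterS -/(u n) /f nrmZr h2.
  have := nrmD b (u n *c u n); have := nrmM (u n) (u n).
  have : nrm (u n) * nrm (u n) <= q * q by rewrite ler_pM ?nrm_ge0.
  rewrite -/q; set a := nrm (u n) * _; set d := nrm (_ + _); set e := nrm (_ *c _).
  by nra.
have du n : nrm (u n - u n.+1) <= q ^+ n * q.
  elim: n => [|n IH]; first by rewrite expr0 mul1r sub0r nrmN uq.
  (* x^2 - y^2 = x (x - y) + (x - y) y needs no commutativity; both iterates have norm at most [q],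
     so consecutive differences shrink by the factor [q]. *)
  have -> : u n.+1 - u n.+2 =
      half *: (u n *c (u n - u n.+1) + (u n - u n.+1) *c u n.+1).
    rewrite {1 4}/u !iterS -/(u n) -/(u n.+1) /f -scalerBr; congr (_ *: _).
    by rewrite opprD addrACA subrr add0r cmulBr cmulBl addrA subrK.
  rewrite nrmZr h2; set d := u n - u n.+1 in IH *.
  have h : nrm (u n *c d + d *c u n.+1) <= (q + q) * (q ^+ n * q).
    apply: le_trans (nrmD _ _) _; rewrite mulrDl; apply: lerD.
      by apply: le_trans (nrmM _ _) _; rewrite ler_pM ?nrm_ge0.
    by apply: le_trans (nrmM _ _) _; rewrite mulrC ler_pM ?nrm_ge0.
  rewrite exprS; set t := q ^+ n * q in h *.
  have -> : q * q ^+ n * q = 2^-1 * ((q + q) * t).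
    by rewrite /t; field.
  by rewrite ler_pM2l// invr_gt0.
have q1 : 0 < 1 - q by rewrite subr_gt0.
have dum n m : nrm (u n - u (n + m)%N) * (1 - q) <= q ^+ n * q * (1 - q ^+ m).
  elim: m => [|m IH]; first by rewrite addn0 subrr nrm0 mul0r expr0 subrr mulr0.
  rewrite addnS; apply: (@le_trans _ _ ((nrm (u n - u (n + m)%N) + q ^+ (n + m) * q) * (1 - q))).
    rewrite ler_pM2r//; apply: le_trans (nrm_tri (u (n + m)%N) _ _) _.
    by rewrite lerD2l du.
  rewrite mulrDl; apply: le_trans (lerD IH (lexx _)) _.
  by rewrite exprD exprS le_eqVlt; apply/orP; left; apply/eqP; ring.
have [l hl] : exists l, forall e : R, 0 < e ->
    exists N, forall n, (N <= n)%N -> nrm (l - u n) < e.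
  apply: complete_nrm => e e0.
  have [|N hN] := @expr_lt_eps _ q (e * (1 - q)) _ (mulr_gt0 e0 q1).
    by rewrite q0.
  exists N => n Nn; rewrite -(ltr_pM2r q1).
  rewrite -(subnKC Nn); apply: le_lt_trans (dum _ _) _.
  apply: le_lt_trans (hN N (leqnn _)); rewrite -mulrA ler_piMr ?exprn_ge0//.
  rewrite mulr_ile1 ?(ltW b1) ?subr_ge0 ?exprn_ile1 ?(ltW b1)//.
  by rewrite gerBl exprn_ge0.
exists l; split; last first.
  move=> X clX X0 Xf; apply: closed_limit clX _ => e /hl[N /(_ N (leqnn _))].
  by exists (u N) => //; elim: (N) => //= n; exact: Xf.
apply/eqP; rewrite -subr_eq0; apply/eqP; apply: nrm_eps => e e0.
set m := nrm l; have m0 : 0 <= m := nrm_ge0 l.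
(* The weights: 2 for the two copies of [l - u N.+1], [m] for l (l - u_N), and [q] for (l - u_N)
   u_N. *)
have c0 : 0 < 2 + (q + m) by lra.
have [N hN] := hl _ (divr_gt0 e0 c0).
have h1 := hN N (leqnn _); have h3 := hN N.+1 (leqnSn _).
have -> : l + l - (b + l *c l) = ((l - u N.+1) + (l - u N.+1)) -
    (l *c (l - u N) + (l - u N) *c u N).
  have -> : l *c (l - u N) + (l - u N) *c u N = l *c l - u N *c u N.
    by rewrite cmulBr cmulBl addrA subrK.
  have uN : u N.+1 + u N.+1 = b + u N *c u N.
    by rewrite /u iterS -/(u N) -scalerDr scalerDr half_half.
  rewrite [in RHS]addrACA -[in RHS]opprD uN !opprD !opprK !addrA.
  by rewrite [RHS]addrAC subrK.
set d := nrm (l - u N) in h1; set d' := nrm (l - u N.+1) in h3.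
set eps := e / _ in h1 h3.
have -> : e = eps * (2 + (q + m)) by rewrite divfK// gt_eqF.
apply: le_trans (nrmB _ _) _.
have a1 := nrmD (l - u N.+1) (l - u N.+1); rewrite -/d' in a1.
have a2 := nrmD (l *c (l - u N)) ((l - u N) *c u N).
have a3 := nrmM l (l - u N); have a4 := nrmM (l - u N) (u N).
rewrite -/d -/m in a3 a4.
have a5 : d * nrm (u N) <= eps * q by rewrite ler_pM ?nrm_ge0// ltW.
have a6 : m * d <= eps * m by rewrite mulrC ler_pM ?nrm_ge0// ltW.
by nra.
Qed.

End CstarTheory.

Lemma subrBB (V : zmodType) (a b c d : V) : (a - b) - (c - d) = (a - c) - (b - d).
Proof. by rewrite opprD addrACA -opprD. Qed.

(** * Square roots in corners and orthogonality of projections *)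

Section Positivity.
Variables (R : realType) (B : cstarAlgType R).
Local Notation C := R[i].
Implicit Types x y z : B.

Lemma cstarZr (a : R) x : cstar (a%:C%C *: x) = a%:C%C *: cstar x.
Proof. by rewrite cstarZ; congr (_ *: _); exact: conjc_real. Qed.

(** Only additivity is asked of [f], because [cstar x - x], one of the maps it serves, is not
    complex linear in [x]. *)
Lemma closed_additive_kernel (f : B -> B) (K : R) :
  (forall x y, f (x - y) = f x - f y) -> (forall x, nrm (f x) <= K * nrm x) ->
  closed [set x | f x = 0].
Proof.
move=> fB fK l /closure_nrm cl; apply: nrm_eps => e e0 /=.
have K1 : 0 < `|K| + 1 by rewrite ltr_wpDl.
have [x /= fx lx] := cl _ (divr_gt0 e0 K1).
have -> : f l = f (l - x) by rewrite fB fx subr0.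
apply: le_trans (fK _) _; apply: (@le_trans _ _ ((`|K| + 1) * nrm (l - x))).
  by rewrite ler_wpM2r ?nrm_ge0// (le_trans (ler_norm _))// lerDl.
by rewrite -(divfK (lt0r_neq0 K1) e) mulrC ler_pM2r// ltW.
Qed.

Lemma closed_selfadjoint : closed [set x : B | cstar x - x = 0].
Proof.
apply: (@closed_additive_kernel (fun x => cstar x - x) 2) => [x y|x].
  by rewrite cstarB subrBB.
by apply: le_trans (nrmB _ _) _; rewrite nrm_cstar mulrDl mul1r.
Qed.

Lemma closed_commutant w1 w2 : closed [set x : B | w1 *c x - x *c w2 = 0].
Proof.
apply: (@closed_additive_kernel (fun x => w1 *c x - x *c w2) (nrm w1 + nrm w2))
  => [x y|x].
  by rewrite cmulBr cmulBl subrBB.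
apply: le_trans (nrmB _ _) _; rewrite mulrDl.
by apply: lerD; [exact: nrmM|rewrite mulrC; exact: nrmM].
Qed.

Lemma closed_left_unit e : closed [set x : B | e *c x - x = 0].
Proof.
apply: (@closed_additive_kernel (fun x => e *c x - x) (nrm e + 1)) => [x y|x].
  by rewrite cmulBr subrBB.
by apply: le_trans (nrmB _ _) _; rewrite mulrDl mul1r lerD2r nrmM.
Qed.


(* The corner [e B e] plays the role of a unital algebra: a positive element
   [h] of it with [nrm (e - h) < 1] has a square root there. *)
Lemma corner_sqrt (e h : B) : projection e -> cstar h = h -> e *c h = h ->
  nrm (e - h) < 1 -> exists y,
    [/\ cstar y = y, y *c y = h, e *c y = y &
        forall w, w *c e = e *c w -> w *c h = h *c w -> w *c y = y *c w].
Proof.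
move=> [es ee] hs eh /sqrt_fixpoint[k [kE kX]].
have ks : [set x | cstar x - x = 0] k.
  apply: (kX _ closed_selfadjoint) => [|x /= /subr0_eq xs].
    by rewrite /= cstar0 subrr.
  by rewrite cstarZr cstarD cstarB cstarM es hs xs subrr.
have ek : [set x | e *c x - x = 0] k.
  apply: (kX _ (@closed_left_unit e)) => [|x /= /subr0_eq ex].
    by rewrite /= cmul0r subrr.
  by rewrite cmulZr cmulDr cmulBr ee eh cmulA ex subrr.
have ke : k *c e = k.
  by rewrite -{1}(subr0_eq ks) -es -cstarM (subr0_eq ek) (subr0_eq ks).
(* Since 2 k = (e - h) + k^2 and e k = k e = k, one gets (e - k)^2 = e - 2 k + k^2 = h. *)
exists (e - k); split.
- by rewrite cstarB es (subr0_eq ks).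
- rewrite cmulBl !cmulBr ee (subr0_eq ek) ke opprB addrACA -opprD kE.
  by rewrite opprD opprB addrACA subrr addr0 addrC subrK.
- by rewrite cmulBr ee (subr0_eq ek).
move=> w we wh; have wk : [set x | w *c x - x *c w = 0] k.
  apply: (kX _ (@closed_commutant w w)) => [|x /= /subr0_eq wx].
    by rewrite /= cmul0l cmul0r subrr.
  rewrite cmulZr cmulZl cmulDr cmulDl cmulBr cmulBl we wh.
  by rewrite (cmulA w) wx -(cmulA x w) wx cmulA subrr.
by rewrite cmulBr cmulBl we (subr0_eq wk).
Qed.

(* For commuting square roots [y] and [z] of [d e + (1 - d) c] and
   [d e - (1 - d) c], [|y + i z|^2 = |y^2 + z^2| <= 2 d]; hence [y], and with it
   [c], tends to 0 with [d]. *)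
Lemma unit_extreme (e c : B) : projection e -> cstar c = c -> e *c c = c ->
  nrm (e + c) <= 1 -> nrm (e - c) <= 1 -> c = 0.
Proof.
move=> ep cs ec hp hm; have [es ee] := ep.
have ce : c *c e = c by rewrite -{1}cs -{1}es -cstarM ec cs.
(* This is (1 - d) |c| <= |h1| + d |e| <= 2 d + d, solved for |c|. *)
suff le d : 0 < d < 1 -> nrm c <= d * (3 + nrm c).
  apply: nrm_le0; apply/ler_addgt0Pr => t t0; rewrite add0r.
  have n0 := nrm_ge0 c; have N0 : 0 < 3 + nrm c by lra.
  have [t1|t1] := ltP (t / (3 + nrm c)) 1.
    by have := le (t / (3 + nrm c)); rewrite divfK ?gt_eqF// t1 divr_gt0//; apply.
  by move: t1; rewrite ler_pdivlMr// mul1r; lra.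
move=> /andP[d0 d1]; have [l lE] : exists l : R, l = 1 - d by exists (1 - d).
(* The elements e - h1 and e - h2 are 1 - d times e - c and e + c: the factor 1 - d supplies the
   strict inequality that [corner_sqrt] requires. *)
pose h1 := d%:C%C *: e + l%:C%C *: c; pose h2 := d%:C%C *: e - l%:C%C *: c.
have e_l : e = d%:C%C *: e + l%:C%C *: e.
  by rewrite -scalerDl -rmorphD /= lE addrC subrK scale1r.
have l0 : `|l| = l by rewrite ger0_norm lE //; lra.
have eh1 : e - h1 = l%:C%C *: (e - c).
  by rewrite {1}e_l /h1 opprD addrACA subrr add0r -scalerBr.
have eh2 : e - h2 = l%:C%C *: (e + c).
  by rewrite {1}e_l /h2 opprB addrC addrA subrK -scalerDr addrC.
have l1 : l < 1 by rewrite lE; lra.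
have n1 : nrm (e - h1) < 1.
  by rewrite eh1 nrmZr l0; have := nrm_ge0 (e - c); rewrite lE; nra.
have n2 : nrm (e - h2) < 1.
  by rewrite eh2 nrmZr l0; have := nrm_ge0 (e + c); rewrite lE; nra.
have h1s : cstar h1 = h1 by rewrite cstarD !cstarZr es cs.
have h2s : cstar h2 = h2 by rewrite cstarB !cstarZr es cs.
have eh1' : e *c h1 = h1 by rewrite cmulDr !cmulZr ee ec.
have eh2' : e *c h2 = h2 by rewrite cmulBr !cmulZr ee ec.
have h1e : h1 *c e = h1 by rewrite cmulDl !cmulZl ee ce.
have h2e : h2 *c e = h2 by rewrite cmulBl !cmulZl ee ce.
have h12 : h1 *c h2 = h2 *c h1.
  have h2E : h2 = (d + d)%:C%C *: e - h1.
    by rewrite /h2 /h1 rmorphD /= scalerDl opprD addrA addrK.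
  by rewrite h2E cmulBl cmulBr cmulZl cmulZr h1e eh1'.
have [y [ys yy ey yc]] := corner_sqrt ep h1s eh1' n1.
have [z [zs zz ez zc]] := corner_sqrt ep h2s eh2' n2.
have ze : z *c e = z by rewrite -{1}zs -{1}es -cstarM ez zs.
have zy : z *c y = y *c z.
  by apply: yc; rewrite ?ez// -zc// ?h1e.
pose x := y + 'i *: z.
have xs : cstar x = y - 'i *: z by rewrite cstarD cstarZ conjCi ys zs scaleNr.
have xx : cstar x *c x = (d + d)%:C%C *: e.
  rewrite xs /x cmulBl !cmulDr !cmulZl !cmulZr scalerA -expr2 sqrCi scaleN1r.
  rewrite yy zz zy opprB addrACA subrr addr0.
  by rewrite /h1 /h2 rmorphD /= scalerDl addrACA subrr addr0.
have nx : nrm x ^+ 2 <= d + d.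
  rewrite -nrmMstar xx nrmZr ger0_norm ?addr_ge0 ?(ltW d0)//.
  by rewrite ler_piMr ?nrm_projection_le// addr_ge0// ltW.
have yE : y = (2^-1)%:C%C *: (x + cstar x).
  by rewrite xs /x addrACA subrr addr0 scalerDr half_half.
have ny : nrm y <= nrm x.
  rewrite yE nrmZr ger0_norm ?invr_ge0//.
  by have := nrmD x (cstar x); rewrite nrm_cstar; lra.
have nh1 : nrm h1 <= d + d.
  by rewrite -yy -{1}ys nrmMstar (le_trans _ nx)// lerXn2r ?nnegrE ?nrm_ge0.
have cE : l%:C%C *: c = h1 - d%:C%C *: e by rewrite /h1 addrC addrA addNr add0r.
have : l * nrm c <= (d + d) + d.
  rewrite -{1}l0 -nrmZr cE; apply: le_trans (nrmB _ _) _; apply: lerD => //.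
  by rewrite nrmZr ger0_norm ?ler_piMr ?nrm_projection_le// ltW.
rewrite lE; lra.
Qed.

(* With [q = p i] and [a k = q (p k) q], the sum of all [p k] compressed by [q]
   is [q + a j + rest]; as it has norm at most 1 and [rest] is positive, [q + a j]
   and [q - a j], suitably scaled, are contractions, so that [unit_extreme]
   applies to [a j]. *)
Lemma orthogonal_projections (T : eqType) (s : seq T) (p : T -> B) :
  uniq s -> (forall i, i \in s -> projection (p i)) ->
  projection (\sum_(i <- s) p i) ->
  forall i j, i \in s -> j \in s -> i != j -> p i *c p j = 0.
Proof.
move=> us ps sp j i js is_ ji.
have [qs qq] := ps _ is_; set q := p i in qs qq *.
pose a k := q *c p k *c q.
(* For x = q - p_k q, both q x and x^* x equal q - a_k; hence |x|^2 <= |x|. *)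
have le1 k : k \in s -> nrm (q - a k) <= 1.
  move=> ks; have [ks' kk] := ps _ ks.
  have aE : q - a k = q *c (q - p k *c q) by rewrite cmulBr qq /a cmulA.
  have aE' : q - a k = cstar (q - p k *c q) *c (q - p k *c q).
    rewrite cstarB cstarM qs ks' cmulBl !cmulBr qq.
    rewrite -!(cmulA q) (cmulA (p k) (p k)) kk -/(a k).
    by rewrite subrr subr0 /a cmulA.
  have n1 : nrm (q - a k) <= nrm (q - p k *c q).
    rewrite aE; apply: le_trans (nrmM _ _) _.
    by rewrite ler_piMl ?nrm_ge0// nrm_projection_le.
  have := nrmMstar (q - p k *c q); rewrite -aE' => n2.
  by have := nrm_ge0 (q - p k *c q); nra.
pose rest := [seq k <- s | (k != i) && (k != j)].
pose t : R := (size rest)%:R.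
have sumE : q *c (\sum_(k <- s) p k) *c q = q + a j + \sum_(k <- rest) a k.
  rewrite cmul_sumr cmul_suml (bigD1_seq i)//= -/(a i) {1}/a qq qq -addrA.
  congr (_ + _); rewrite -[LHS]big_filter (bigD1_seq j) ?filter_uniq//=; last first.
    by rewrite mem_filter ji.
  congr (_ + _); rewrite -big_filter -filter_predI.
  by rewrite /rest; congr (\sum_(k <- _) _); apply: eq_filter => k /=; rewrite andbC.
have restn : nrm (\sum_(k <- rest) (q - a k)) <= t.
  apply: le_trans (nrm_sum _ _ _) _; rewrite /t -[X in _ <= X%:R]sum1_size natr_sum.
  rewrite [leLHS]big_seq [leRHS]big_seq; apply: ler_sum => k.
  by rewrite mem_filter => /andP[_]; exact: le1.
have restE : \sum_(k <- rest) (q - a k) = t%:C%C *: q - \sum_(k <- rest) a k.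
  rewrite sumrB; congr (_ - _).
  by rewrite big_const_seq count_predT iter_addr_0 /t raddfMn /= -scaler_nat.
have t0 : 0 <= t by rewrite ler0n.
have T0 : 0 < 1 + t by rewrite ltr_pwDl.
have qn : nrm q <= 1 by exact: nrm_projection_le.
have scq (x : B) : q + t%:C%C *: q + x = (1 + t)%:C%C *: (q + (1 + t)^-1%:C%C *: x).
  rewrite scalerDr scalerA -rmorphM /= divff ?gt_eqF// scale1r.
  by rewrite rmorphD /= scalerDl scale1r.
have red x : nrm (q + t%:C%C *: q + x) <= 1 + t -> nrm (q + (1 + t)^-1%:C%C *: x) <= 1.
  by move=> h; rewrite -(ler_pM2l T0) mulr1; move: h; rewrite scq nrmZr (ger0_norm (ltW T0)).
have a0 : (1 + t)^-1%:C%C *: a j = 0.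
  apply: (@unit_extreme q) => //.
  - by rewrite cstarZr /a !cstarM qs (ps _ js).1 cmulA.
  - by rewrite cmulZr /a !cmulA qq.
  (* Positivity of the rest enters only through the bounds |q - a_k| <= 1: q + t q + a_j is the
     compressed sum plus the [t] terms q - a_k, so its norm is at most 1 + t. *)
  - apply: red; have -> : q + t%:C%C *: q + a j = q *c (\sum_(k <- s) p k) *c q +
        \sum_(k <- rest) (q - a k).
      rewrite sumE restE -!addrA; congr (_ + _).
      by rewrite [X in a j + X]addrC subrK addrC.
    apply: le_trans (nrmD _ _) _; apply: lerD => //.
    apply: le_trans (nrmM _ _) _; apply: mulr_ile1; rewrite ?nrm_ge0//.
    apply: le_trans (nrmM _ _) _; apply: mulr_ile1; rewrite ?nrm_ge0//.
    exact: nrm_projection_le.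
  - rewrite -scalerN; apply: red; rewrite addrAC.
    apply: le_trans (nrmD _ _) _; apply: lerD; first exact: le1.
    by rewrite nrmZr ger0_norm// ler_piMr.
have {a0} a0 : a j = 0.
  move/(congr1 (fun x => (1 + t)%:C%C *: x)): a0.
  by rewrite scalerA -rmorphM /= divff ?gt_eqF// scale1r scaler0.
(* |p_j q|^2 = |q p_j q| = |a_j| = 0. *)
have := nrmMstar (p j *c q); rewrite cstarM qs (ps _ js).1.
rewrite -!cmulA (cmulA (p j) (p j)) (ps _ js).2 cmulA -/(a j) a0 nrm0 => /esym/eqP.
by rewrite expf_eq0 /= => /eqP n0; apply: nrm_le0; rewrite n0.
Qed.

End Positivity.

(* If [2 k = x^* x + k^2] then [|T xi|^2 = |xi|^2 - |xi - K xi|^2] for the images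
   [T] and [K] of [x] and [k]. *)
Lemma star_hom_contractive (R : realType) (B : cstarAlgType R) (H : hilbertType R)
  (phi : B -> BH H) : star_hom phi -> forall x, nrm (phi x) <= nrm x.
Proof.
move=> [plin pM pS].
have pD x y : phi (x + y) = phi x + phi y.
  by have := plin 1 x y; rewrite !scale1r.
have p0 : phi 0 = 0 by apply: (addrI (phi 0)); rewrite -pD !addr0.
have pZ a x : phi (a *: x) = a *: phi x by have := plin a x 0; rewrite p0 !addr0.
suff le1 x : nrm x < 1 -> nrm (phi x) <= 1.
  move=> x; apply/ler_addgt0Pr => e e0.
  have t0 : 0 < nrm x + e by rewrite ltr_wpDl ?nrm_ge0.
  have := le1 ((nrm x + e)^-1%:C%C *: x).
  rewrite pZ !nrmZr ger0_norm ?invr_ge0 ?(ltW t0)// !ler_pdivrMl// ltr_pdivrMl//.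
  by rewrite !mulr1 ltrDl; exact.
move=> x1; have b1 : nrm (cstar x *c x) < 1.
  by rewrite nrmMstar expr_lt1 ?nrm_ge0.
have [k [kE kX]] := sqrt_fixpoint b1.
have ks : cstar k = k.
  suff : [set x : B | cstar x - x = 0] k by move=> /subr0_eq.
  apply: (kX _ (@closed_selfadjoint _ B)) => [|y /= /subr0_eq ys].
    by rewrite /= cstar0 subrr.
  by rewrite cstarZr cstarD !cstarM cstarK ys subrr.
set K : bop H := phi k; set T : bop H := phi x.
have Ks : adjoint K = K by rewrite /K -[LHS](pS k) ks.
have KE (xi : H) : K xi + K xi = adjoint T (T xi) + K (K xi).
  have : phi k + phi k = cstar (phi x) *c phi x + phi k *c phi k.
    by rewrite -pS -!pM -!pD kE.
  by move=> /(congr1 (fun U : bop H => U xi)).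
have Tn (xi : H) : `|T xi| <= 1 * `|xi|.
  rewrite mul1r -(@ler_pXn2r _ 2%N)// ?nnegrE// !hdotE -subr_ge0.
  have -> : hdot H xi xi - hdot H (T xi) (T xi) = hdot H (xi - K xi) (xi - K xi).
    have h : hdot H xi (K xi) + hdot H xi (K xi) =
        hdot H (T xi) (T xi) + hdot H (K xi) (K xi).
      by rewrite -hdotDr KE hdotDr -adjointP [hdot H (K xi) _]adjointP Ks.
    rewrite hdotBl !hdotBr [hdot H (K xi) xi]adjointP Ks.
    by rewrite -[X in _ - X](addrK (hdot H (K xi) (K xi))) -h; ring.
  by rewrite -hdotE exprn_ge0.
have : `|T| <= 1 by apply: bop_norm_leC.
by rewrite -lecR nrmE.
Qed.

(** * Exponential versus polynomial growth *)

Section PowerTrick.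
Variable R : realType.

(** A crude root by repeated square roots. [power_trick] takes it with exponent [r.+1], one more
    than the degree of the polynomial there, so that Bernoulli's linear bound is enough. *)
Lemma root_gt1 (q : nat) (a : R) : 1 < a -> exists2 b : R, 1 < b & b ^+ q <= a.
Proof.
elim: q a => [|q IH] a a1; first by exists 2; rewrite ?expr0 ?ltW// ltr1n.
have s1 : 1 < Num.sqrt a by rewrite -[X in X < _]sqrtr1 ltr_sqrt// (lt_trans _ a1).
have [b b1 bq] := IH _ s1; exists (Num.min b (Num.sqrt a)); first by rewrite lt_min b1.
set c := Num.min _ _; have c1 : 0 <= c by rewrite le_min !(ltW (lt_trans ltr01 _)).
rewrite exprS -[a in leRHS]sqr_sqrtr ?(ltW (lt_trans ltr01 a1))// expr2.
apply: ler_pM; rewrite ?exprn_ge0// ?ge_min ?lexx ?orbT//.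
by apply: le_trans bq; rewrite lerXn2r ?nnegrE ?ge_min ?lexx// ltW// (lt_trans ltr01).
Qed.

Lemma bernoulli_le (x : R) n : 0 <= x -> n%:R * x <= (1 + x) ^+ n.
Proof.
move=> x0; have : 1 + n%:R * x <= (1 + x) ^+ n; last by apply: le_trans; rewrite lerDr.
elim: n => [|n IH]; first by rewrite mul0r addr0 expr0.
rewrite exprS -natr1; apply: le_trans (ler_wpM2l _ IH); last by rewrite addr_ge0.
have : 0 <= n%:R * x * x by rewrite !mulr_ge0.
lra.
Qed.

(** If m < t, choose b > 1 with b^(r+1) <= t / m; then (t / m)^N is at least (N (b - 1))^(r+1),
    which outgrows N^r. Only exponents N = 2^k occur, because the C*-identity controls norms under
    repeated squaring. *)
Lemma power_trick (t m c : R) (d r : nat) : 0 <= t -> 0 <= m ->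
  (forall k, t ^+ (2 ^ k) <= c * ((d * 2 ^ k + 1) ^ r)%:R * m ^+ (2 ^ k)) -> t <= m.
Proof.
move=> t0 m0 h; rewrite leNgt; apply/negP => mt.
have [m00|mn0] := eqVneq m 0.
  by move: (h 0) mt; rewrite m00 !expr1 mulr0 => /le_lt_trans /[apply]; rewrite ltxx.
have {m0 mn0} m0 : 0 < m by rewrite lt_def mn0.
have a1 : 1 < t / m by rewrite ltr_pdivlMr// mul1r.
have [b b1 ba] := root_gt1 r.+1 a1.
have b0 : 0 < b - 1 by rewrite subr_gt0.
(* [c'] absorbs the constant term: d N + 1 <= (d + 1) N for N >= 1. *)
pose c' := c * (d.+1 ^ r)%:R; pose e := (b - 1) ^+ r.+1.
have c0 : 0 <= c.
  have := le_trans (exprn_ge0 _ t0) (h 0).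
  by rewrite -mulrA pmulr_lge0// mulr_gt0 ?exprn_gt0// ltr0n expn_gt0 addn1.
have e0 : 0 < e by rewrite exprn_gt0.
have le k : k%:R * e <= c'.
  have N0 : 0 < (2 ^ k)%:R :> R by rewrite ltr0n expn_gt0.
  apply: (@le_trans _ _ ((2 ^ k)%:R * e)).
    by rewrite ler_pM2r// ler_nat ltnW// ltn_expl.
  have natle q : ((d * 2 ^ k + 1) ^ q <= (d.+1 * 2 ^ k) ^ q)%N.
    by case: q => // q; rewrite leq_exp2r// mulSn addnC leq_add2r expn_gt0.
  have hN : (t / m) ^+ (2 ^ k) <= c' * (2 ^ k)%:R ^+ r.
    rewrite expr_div_n ler_pdivrMr ?exprn_gt0//; apply: le_trans (h k) _.
    rewrite ler_pM2r ?exprn_gt0// /c' -mulrA ler_wpM2l// -natrX -natrM ler_nat.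
    by rewrite -expnMn natle.
  rewrite -(ler_pM2r (exprn_gt0 r N0)) mulrAC -exprS -exprMn.
  apply: le_trans hN; apply: le_trans (lerXn2r _ _ _ ba).
  - rewrite -exprM mulnC exprM lerXn2r ?nnegrE ?mulr_ge0 ?(ltW b0) ?(ltW N0)//.
      by rewrite exprn_ge0// ltW// (lt_trans ltr01).
    by have := bernoulli_le (2 ^ k) (ltW b0); rewrite [1 + _]addrC subrK.
  - by rewrite nnegrE exprn_ge0// ltW// (lt_trans ltr01).
  - by rewrite nnegrE ltW// (lt_trans ltr01).
have := le (Num.bound (c' / e)); rewrite -ler_pdivlMr// leNgt => /negP; apply.
by apply: archi_boundP; rewrite divr_ge0 ?mulr_ge0// ltW.
Qed.

End PowerTrick.

(** * Words *)

Section WordTheory.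
Variables (r : nat) (A : finType) (M : 'I_r -> A -> A -> int).
Local Notation shape := 'rV[int]_r.
Local Notation e_ := (delta_mx 0 : 'I_r -> 'rV[int]_r).
Implicit Types (k l m n : shape) (u v w x : word M).

Lemma zleP m n : reflect (forall i, m 0 i <= n 0 i) (zle m n).
Proof. exact: forallP. Qed.

Lemma zle_refl m : zle m m.
Proof. exact/zleP. Qed.

Lemma zle_add m n k l : zle m n -> zle k l -> zle (m + k) (n + l).
Proof. by move=> /zleP h /zleP h'; apply/zleP => i; rewrite !mxE lerD. Qed.

Lemma zle_addr m k : zle 0 k -> zle m (m + k).
Proof. by move=> k0; rewrite -{1}[m]addr0; apply: zle_add => //; exact: zle_refl. Qed.

Lemma zle_trans m n k : zle m n -> zle n k -> zle m k.
Proof.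
by move=> /zleP h /zleP h'; apply/zleP => i; apply: le_trans (h i) (h' i).
Qed.

Lemma zle_sub m n : zle m n = zle 0 (n - m).
Proof.
by apply/zleP/zleP => h i; have := h i; rewrite !mxE subr_ge0.
Qed.

Lemma zle0_add m n : zle 0 m -> zle 0 n -> zle 0 (m + n).
Proof. by move=> m0 n0; rewrite -[0]addr0 zle_add. Qed.

Lemma zle0_delta j : zle 0 (e_ j).
Proof. by apply/zleP => i; rewrite !mxE; case: (_ && _). Qed.

Lemma zle_anti m n : zle m n -> zle n m -> m = n.
Proof.
by move=> /zleP h /zleP h'; apply/rowP => i; apply/le_anti; rewrite h h'.
Qed.

(** Induction on the sum of the coordinates. The steps are unit vectors because the third relation
    lengthens words by one e_j at a time. *)
Lemma zle0_ind (P : shape -> Prop) : P 0 ->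
  (forall k j, zle 0 k -> P k -> P (k + e_ j)) -> forall k, zle 0 k -> P k.
Proof.
move=> P0 PS k; pose sz (k : shape) : nat := (\sum_i `|k ord0 i|)%N.
have [N] := ubnP (sz k); elim: N k => // N IH k kN k0.
have [->//|kn0] := eqVneq k 0.
have [j kj] : exists j, k 0 j != 0.
  apply/existsP; rewrite -negb_forall; apply: contra kn0 => /forallP h.
  by apply/eqP/rowP => i; rewrite mxE; apply/eqP.
have kj1 : (1 : int) <= k 0 j.
  by have := zleP _ _ k0 j; rewrite mxE => h; move: kj h; case: (k 0 j) => [[]|].
have k'E i : i != j -> (k - e_ j) 0 i = k 0 i.
  by move=> ij; rewrite !mxE (negbTE ij) subr0.
have k'j : (k - e_ j) 0 j = k 0 j - 1 by rewrite !mxE !eqxx.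
rewrite -[k](subrK (e_ j)).
have k'0 : zle 0 (k - e_ j).
  apply/zleP => i; have [->|ij] := eqVneq i j.
    by rewrite k'j mxE subr_ge0.
  by rewrite k'E//; exact: (zleP _ _ k0 i).
apply: PS => //; apply: IH => //.
rewrite ltnS in kN; apply: leq_trans kN; rewrite /sz (bigD1 j)//= [X in (_ <= X)%N](bigD1 j)//=.
rewrite k'j (eq_bigr (fun i => `|k ord0 i|%N)) => [|i ij]; last by rewrite k'E.
move: kj1; set t := (\sum_(_ | _) _)%N; rewrite -[k ord0 j]/(k 0 j); lia.
Qed.


Lemma boxP m n k : reflect (zle m k /\ zle k n) (box m n k).
Proof. exact: andP. Qed.

Lemma wmap_in w l : box 0 (wshape w) l -> exists a, wmap w l = Some a.
Proof. by rewrite -wmap_dom; case: wmap => // a; exists a. Qed.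

Lemma wmap_out w l : ~~ box 0 (wshape w) l -> wmap w l = None.
Proof. by rewrite -wmap_dom; case: wmap. Qed.

Lemma word_eq w x : wshape w = wshape x ->
  (forall l, box 0 (wshape w) l -> wmap w l = wmap x l) -> w = x.
Proof.
move=> wx h; apply: wordP => // l; have [/h//|out] := boolP (box 0 (wshape w) l).
by rewrite !wmap_out// -wx.
Qed.

Lemma box0 k : zle 0 k -> box 0 k 0.
Proof. by move=> k0; apply/boxP; split => //; exact: zle_refl. Qed.

Lemma boxT k : zle 0 k -> box 0 k k.
Proof. by move=> k0; apply/boxP; split => //; exact: zle_refl. Qed.

Lemma box_shift m k l : zle 0 k -> box 0 m l -> box 0 (m + k) (l + k).
Proof.
move=> k0 /boxP[l0 lm]; apply/boxP; split; first exact: zle0_add.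
by apply: zle_add => //; exact: zle_refl.
Qed.

Lemma box_widen m k l : zle 0 k -> box 0 m l -> box 0 (m + k) l.
Proof.
by move=> k0 /boxP[l0 lm]; apply/boxP; split=> //; apply: zle_trans lm (zle_addr _ _).
Qed.

Lemma origin_in w : exists a, origin w = Some a.
Proof. by apply/wmap_in/box0/wshape_ge0. Qed.

Lemma terminus_in w : exists a, terminus w = Some a.
Proof. by apply/wmap_in/boxT/wshape_ge0. Qed.

Lemma word_restriction w k m : zle 0 k -> zle 0 m -> zle (m + k) (wshape w) ->
  exists2 x : word M, wshape x = m & forall l, box 0 m l -> wmap x l = wmap w (l + k).
Proof.
move=> k0 m0 mk.
pose f l := if box 0 m l then wmap w (l + k) else None.
have fd l : isSome (f l) = box 0 m l.
  rewrite /f; case: ifP => // /boxP[l0 lm]; rewrite wmap_dom; apply/boxP.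
  split; first exact: zle0_add.
  by apply: zle_trans mk; apply: zle_add => //; exact: zle_refl.
have fa l j a b : f l = Some a -> f (l + delta_mx 0 j) = Some b -> M j b a = 1.
  rewrite /f; case: ifP => // _; case: ifP => // _ wa.
  by rewrite addrAC; exact: wmap_adm.
by exists (Word m0 fd fa) => //= l lm; rewrite /f lm.
Qed.

Lemma is_productP u v w : is_product u v w <->
  [/\ wshape w = wshape u + wshape v,
      forall l, box 0 (wshape u) l -> wmap w l = wmap u l &
      forall l, box 0 (wshape v) l -> wmap w (l + wshape u) = wmap v l].
Proof.
rewrite /is_product /wrestrict subr0 [wshape u + wshape v]addrC addrK.
split=> -[wE hu hv]; split=> // l.
- by move=> lu; rewrite -hu lu addr0.
- by move=> lv; rewrite -hv lv.
- by rewrite addr0; case: ifP => [/hu//|/negbT/wmap_out->].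
- by case: ifP => [/hv//|/negbT/wmap_out->].
Qed.

Hypothesis adm : admissible M.

Lemma wprodP u v : terminus u = origin v -> is_product u v (wprod u v).
Proof.
move=> /(admissible_H1 adm)[w [pw _]]; rewrite /wprod.
by case: xgetP => [x _ px|/(_ w)].
Qed.

Lemma wprod_uniq u v w : terminus u = origin v -> is_product u v w ->
  w = wprod u v.
Proof.
move=> uv pw; have [x [_ xE]] := admissible_H1 adm uv.
by rewrite -(xE _ pw) -(xE _ (wprodP uv)).
Qed.

Section Product.
Variables (u v : word M) (uv : terminus u = origin v).

Lemma wshape_wprod : wshape (wprod u v) = wshape u + wshape v.
Proof. by have /is_productP[] := wprodP uv. Qed.

Lemma wmap_wprodl l : box 0 (wshape u) l -> wmap (wprod u v) l = wmap u l.
Proof. by have /is_productP[_ + _] := wprodP uv; apply. Qed.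

Lemma wmap_wprodr l : box 0 (wshape v) l ->
  wmap (wprod u v) (l + wshape u) = wmap v l.
Proof. by have /is_productP[_ _] := wprodP uv; apply. Qed.

Lemma terminus_wprod : terminus (wprod u v) = terminus v.
Proof.
by rewrite /terminus wshape_wprod addrC wmap_wprodr//; apply/boxT/wshape_ge0.
Qed.

End Product.

(** Both sides agree by uniqueness in (H1): the restriction of (u v) w to the box starting at the
    end of u is made of v and w, hence is v w. *)
Lemma wprodA u v w : terminus u = origin v -> terminus v = origin w ->
  wprod (wprod u v) w = wprod u (wprod v w).
Proof.
move=> uv vw; have uvw : terminus (wprod u v) = origin w by rewrite terminus_wprod.
have u_vw : terminus u = origin (wprod v w) by rewrite origin_wprod.
have u0 := wshape_ge0 u; have v0 := wshape_ge0 v; have w0 := wshape_ge0 w.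
have [x xs xE] : exists2 x : word M, wshape x = wshape v + wshape w & forall l,
    box 0 (wshape v + wshape w) l -> wmap x l = wmap (wprod (wprod u v) w) (l + wshape u).
  apply: word_restriction => //; first exact: zle0_add.
  by rewrite !wshape_wprod// addrC addrA; exact: zle_refl.
have xvw : x = wprod v w.
  apply: wprod_uniq => //; apply/is_productP; split=> // l lb.
    rewrite xE ?box_widen// wmap_wprodl ?wmap_wprodr// wshape_wprod//.
    by rewrite addrC box_shift.
  rewrite xE; last by rewrite addrC box_shift.
  by rewrite -addrA [wshape v + _]addrC -wshape_wprod// wmap_wprodr.
apply: wprod_uniq => //; apply/is_productP; split=> [|l lb|l lb].
- by rewrite !wshape_wprod// addrA.
- by rewrite !wmap_wprodl// wshape_wprod// box_widen.
- by move: lb; rewrite -xvw xs => /xE ->.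
Qed.

Lemma word_factor w k m : zle 0 k -> zle 0 m -> wshape w = k + m ->
  exists x y : word M, [/\ wshape x = k, wshape y = m, terminus x = origin y & w = wprod x y].
Proof.
move=> k0 m0 wE.
have [x xs xE] : exists2 x : word M, wshape x = k & forall l, box 0 k l -> wmap x l = wmap w (l + 0).
  apply: word_restriction => //; first exact: zle_refl.
  by rewrite addr0 wE zle_addr.
have [y ys yE] : exists2 y : word M, wshape y = m & forall l, box 0 m l -> wmap y l = wmap w (l + k).
  by apply: word_restriction => //; rewrite wE addrC zle_refl.
have xy : terminus x = origin y.
  by rewrite /terminus /origin xs xE ?boxT// yE ?box0// addr0 add0r.
exists x, y; split=> //; apply: wprod_uniq => //; apply/is_productP.
rewrite xs ys wE; split=> // l lb; first by rewrite xE// addr0.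
by rewrite yE.
Qed.

Lemma letter a : exists w : word M, [/\ wshape w = 0, origin w = Some a & terminus w = Some a].
Proof.
pose f (l : shape) := if l == 0 then Some a else None.
have fd l : isSome (f l) = box 0 0 l.
  rewrite /f; case: eqVneq => [->|l0]; first by rewrite box0 ?zle_refl.
  apply/esym/negbTE; apply: contra l0 => /boxP[h h']; apply/eqP.
  exact: zle_anti.
have fa l j b c : f l = Some b -> f (l + delta_mx 0 j) = Some c -> M j c b = 1.
  rewrite /f; case: eqVneq => // -> _; rewrite add0r.
  by case: eqVneq => // /matrixP/(_ 0 j); rewrite !mxE !eqxx.
by exists (Word (zle_refl 0) fd fa); split=> //; rewrite /origin /terminus /= /f eqxx.
Qed.

Lemma box_delta j l : box 0 (e_ j) l = (l == 0) || (l == e_ j).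
Proof.
apply/boxP/orP => [[/zleP l0 /zleP l1]|]; last first.
  by case=> /eqP->; split; rewrite ?zle_refl ?zle0_delta.
have lE i : i != j -> l 0 i = 0.
  move=> ij; have := l0 i; have := l1 i; rewrite !mxE/= (negbTE ij) => h1 h2.
  by apply/le_anti; rewrite h1 h2.
have : l 0 j = 0 \/ l 0 j = 1.
  have := l0 j; have := l1 j; rewrite !mxE/= eqxx.
  by case: (l 0 j) => [[|[|n]]|n] //; [left|right].
case=> lj; [left|right]; apply/eqP/rowP => i; rewrite !mxE/=;
  by have [->|/lE->] := eqVneq i j.
Qed.

Lemma edge_word j a b : M j b a = 1 ->
  exists w : word M, [/\ wshape w = e_ j, origin w = Some a & terminus w = Some b].
Proof.
move=> ab; have e0 : e_ j != 0.
  by apply/eqP => /matrixP/(_ 0 j); rewrite !mxE !eqxx.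
pose f (l : shape) := if l == 0 then Some a else if l == e_ j then Some b else None.
have fd l : isSome (f l) = box 0 (e_ j) l.
  by rewrite box_delta /f; case: eqVneq => //= _; case: eqVneq.
have fa l i c d : f l = Some c -> f (l + e_ i) = Some d -> M i d c = 1.
  rewrite /f; case: eqVneq => [->|l0].
    rewrite add0r => -[<-]; case: eqVneq => [/matrixP/(_ 0 i)|_].
      by rewrite !mxE !eqxx.
    case: eqVneq => // /matrixP/(_ 0 i); rewrite !mxE !eqxx /=.
    by case: eqVneq => // -> _ [<-].
  case: eqVneq => // -> _; case: eqVneq => [/matrixP/(_ 0 i)|_].
    by rewrite !mxE !eqxx; case: (i == j).
  by case: eqVneq => // /matrixP/(_ 0 i); rewrite !mxE !eqxx; case: (i == j).
by exists (Word (zle0_delta j) fd fa); split=> //;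
  rewrite /origin /terminus /= /f eqxx// (negbTE e0).
Qed.

Lemma word_connecting a b : exists w : word M, origin w = Some a /\ terminus w = Some b.
Proof.
have /connectP[p] := admissible_H2 adm a b.
elim: p a => [|c p IH] a /=.
  by move=> _ ->; have [w [_ ? ?]] := letter a; exists w.
move=> /andP[/existsP[j /eqP/edge_word[x [_ xa xc]]] /IH{}IH /IH[y [yc yb]]].
have xy : terminus x = origin y by rewrite xc yc.
by exists (wprod x y); rewrite origin_wprod terminus_wprod.
Qed.

Lemma box_sub p m l : box p (p + m) l -> box 0 m (l - p).
Proof.
move=> /boxP[pl lm]; apply/boxP; split; first by rewrite -zle_sub.
by move: lm; rewrite zle_sub [zle (l - p) m]zle_sub opprB addrA [m + p]addrC.
Qed.

(* Two occurrences of [w] in the same word, at offsets differing by [p], make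
   [w] periodic of period [p]. *)
Lemma overlap_periodic w x k m :
  (forall l, box 0 (wshape w) l -> wmap x (l + k) = wmap w l) ->
  (forall l, box 0 (wshape w) l -> wmap x (l + m) = wmap w l) ->
  Defs.periodic (m - k) w.
Proof.
move=> hk hm j jw /box_sub jp.
by rewrite -hk// -hm// opprB addrA subrK.
Qed.

(** Used contrapositively: a word containing a non-periodic factor is itself non-periodic, so
    obstructions to different periods can be collected in one word. *)
Lemma periodic_infix p w x k :
  (forall l, box 0 (wshape w) l -> box 0 (wshape x) (l + k)) ->
  (forall l, box 0 (wshape w) l -> wmap x (l + k) = wmap w l) ->
  Defs.periodic p x -> Defs.periodic p w.
Proof.
move=> sh hk per j jw jp; have jpw := box_sub jp.
rewrite -hk// -[RHS]hk// per ?sh//; first by rewrite addrAC.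
have /boxP[_ h1] := sh _ jw; have /boxP[h2 h3] := sh _ jpw.
apply/boxP; split; first by rewrite zle_sub addrAC.
move: h3; rewrite zle_sub [zle (j + k) _]zle_sub.
by rewrite [j - p + k]addrAC opprB addrA [_ + p]addrC.
Qed.

Lemma periodic_wprodl p u v : terminus u = origin v ->
  Defs.periodic p (wprod u v) -> Defs.periodic p u.
Proof.
move=> uv; apply: (@periodic_infix p u (wprod u v) 0) => l lb; rewrite addr0.
  by rewrite wshape_wprod// box_widen// wshape_ge0.
by rewrite wmap_wprodl.
Qed.

Lemma periodic_wprodr p u v : terminus u = origin v ->
  Defs.periodic p (wprod u v) -> Defs.periodic p v.
Proof.
move=> uv; apply: (@periodic_infix p v (wprod u v) (wshape u)) => l lb.
  by rewrite wshape_wprod// addrC box_shift// wshape_ge0.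
by rewrite wmap_wprodr.
Qed.

(** Periods are excluded one at a time: [u] handles the earlier ones, [v] from (H3) the new one, and
    irreducibility provides [z] leading from [u] to [v]. *)
Lemma aperiodic_word (P : seq shape) a : 0 \notin P -> exists2 w : word M,
  origin w = Some a & forall p, p \in P -> ~ Defs.periodic p w.
Proof.
elim: P => [_|p P IH].
  by have [w [? _]] := word_connecting a a; exists w.
rewrite inE negb_or eq_sym => /andP[p0 /IH[u ua uP]].
have [v vp] := admissible_H3 adm p0.
have [b ub] := terminus_in u; have [c vc] := origin_in v.
have [z [zb zc]] := word_connecting b c.
have uz : terminus u = origin z by rewrite ub zb.
have zv : terminus z = origin v by rewrite zc vc.
have uzv : terminus u = origin (wprod z v) by rewrite origin_wprod.
exists (wprod u (wprod z v)); first by rewrite origin_wprod.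
move=> q; rewrite inE => /orP[/eqP-> | qP] per.
  by apply: vp; apply: (periodic_wprodr zv); apply: (periodic_wprodr uzv).
by apply: (uP _ qP); apply: (periodic_wprodl uzv).
Qed.

End WordTheory.

(** * Decorated words and the defining relations *)

Section DecoratedWords.
Variables (r : nat) (A : finType) (M : 'I_r -> A -> A -> int).
Hypothesis adm : admissible M.
Variables (D : Type) (delta : D -> A).
Local Notation shape := 'rV[int]_r.
Local Notation e_ := (delta_mx 0 : 'I_r -> 'rV[int]_r).
Local Notation dword := (dword M delta).
Implicit Types (u v x y : dword) (w z : word M).

HB.instance Definition _ := gen_eqMixin dword.
HB.instance Definition _ := gen_choiceMixin dword.

Lemma dword_eq u v : deco u = deco v -> dbase u = dbase v -> u = v.
Proof.
case: u v => [d w p] [d' w' p'] /= dd ww; subst d' w'.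
by congr DWord; exact: Prop_irrelevance.
Qed.

Lemma dshape_ge0 u : zle 0 (dshape u).
Proof. exact: wshape_ge0. Qed.

Lemma dshape_dprod u w : dterminus u = origin w ->
  dshape (dprod u w) = dshape u + wshape w.
Proof. exact: wshape_wprod. Qed.

Lemma dterminus_dprod u w : dterminus u = origin w ->
  dterminus (dprod u w) = terminus w.
Proof. exact: terminus_wprod. Qed.

Lemma dprodA u w z : dterminus u = origin w -> terminus w = origin z ->
  dprod (dprod u w) z = dprod u (wprod w z).
Proof. by move=> uw wz; apply: dword_eq => //=; exact: wprodA. Qed.

Lemma dprod_shape0 u w : dterminus u = origin w -> wshape w = 0 -> dprod u w = u.
Proof.
move=> uw w0; apply: dword_eq => //=; apply/esym/wprod_uniq => //.
apply/is_productP; rewrite w0 addr0; split=> // l /boxP[h h'].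
by rewrite -(zle_anti h h') add0r [LHS]uw.
Qed.

Lemma wprod_inj (x y w z : word M) : wshape x = wshape y ->
  terminus x = origin w -> terminus y = origin z ->
  wprod x w = wprod y z -> x = y /\ w = z.
Proof.
move=> xy xw yz e.
have wz : wshape w = wshape z.
  by apply: (addrI (wshape x)); rewrite -wshape_wprod// e wshape_wprod// xy.
split; apply: word_eq => // l lb.
  by rewrite -(wmap_wprodl adm xw)// e wmap_wprodl// -xy.
by rewrite -(wmap_wprodr adm xw)// e xy wmap_wprodr// -wz.
Qed.

Lemma dprod_inj u v w z : dshape u = dshape v -> dterminus u = origin w ->
  dterminus v = origin z -> dprod u w = dprod v z -> u = v /\ w = z.
Proof.
move=> uv uw vz e; have [] // := wprod_inj uv uw vz (congr1 (@dbase _ _ _ _ _) e).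
by move=> euv ewz; split=> //; apply: dword_eq => //; exact: (congr1 (@deco _ _ _ _ _) e).
Qed.

Lemma dword_factor u (k m : shape) : zle 0 k -> zle 0 m -> dshape u = k + m ->
  exists v w, [/\ dshape v = k, wshape w = m, dterminus v = origin w & u = dprod v w].
Proof.
move=> k0 m0 ukm; have [x [w [xk wm xw e]]] := word_factor adm k0 m0 ukm.
have xu : origin x = Some (delta (deco u)).
  by rewrite -dword_compat e origin_wprod.
by exists (DWord xu), w; split=> //; apply: dword_eq.
Qed.

Lemma dterminus_in u : exists a, dterminus u = Some a.
Proof. exact: terminus_in. Qed.

Lemma steps_exist j (a : option A) : exists s : seq (word M),
  uniq s /\ [set w : word M | wshape w = e_ j /\ origin w = a] = [set` s].
Proof.
have /finite_seqP[s sE] : finite_set [set w : word M | wshape w = e_ j /\ origin w = a].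
  by apply: sub_finite_set (finite_words_e M j) => w [].
by exists (undup s); rewrite undup_uniq sE; split=> //; apply/seteqP; split=> w /=;
  rewrite mem_undup.
Qed.

Definition steps j a := projT1 (cid (steps_exist j a)).

Lemma steps_uniq j a : uniq (steps j a).
Proof. by rewrite /steps; case: cid => s []. Qed.

Lemma steps_set j a : [set w : word M | wshape w = e_ j /\ origin w = a] = [set` steps j a].
Proof. by rewrite /steps; case: cid => s []. Qed.

Lemma mem_steps j a w : (w \in steps j a) <-> wshape w = e_ j /\ origin w = a.
Proof.
have /seteqP[h h'] := steps_set j a.
by split; [exact: h'|exact: h].
Qed.

Section Family.
Variables (R : realType) (B : cstarAlgType R) (t : dword -> dword -> B).
Hypothesis rel : defining_relations t.

Lemma family_sum j u v : dterminus u = dterminus v ->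
  t u v = \sum_(w <- steps j (dterminus u)) t (dprod u w) (dprod v w).
Proof.
by move=> uv; rewrite (rel_sum rel j uv) steps_set -fsbig_seq// steps_uniq.
Qed.

Lemma family_projection u : projection (t u u).
Proof. by split; [rewrite (rel_star rel)|rewrite (rel_mul rel)]. Qed.

(** The third relation for the pair (u, u) writes a projection as the sum of the projections of its
    one-step extensions. *)
Lemma step_orthogonal j u w z : w \in steps j (dterminus u) ->
  z \in steps j (dterminus u) -> w != z ->
  t (dprod u w) (dprod u w) *c t (dprod u z) (dprod u z) = 0.
Proof.
apply: (@orthogonal_projections _ B _ _ (fun w => t (dprod u w) (dprod u w))).
- exact: steps_uniq.
- by move=> x _; exact: family_projection.
- by rewrite -family_sum//; exact: family_projection.
Qed.

Lemma step_mul j u v w : w \in steps j (dterminus u) -> dterminus u = dterminus v ->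
  t (dprod u w) (dprod u w) *c t u v = t (dprod u w) (dprod v w).
Proof.
move=> wu uv; have [wj uw] := (mem_steps _ _ _).1 wu.
have term z : z \in steps j (dterminus u) -> dterminus (dprod u z) = dterminus (dprod v z).
  by move=> /mem_steps[_ zo]; rewrite !dterminus_dprod// -uv.
rewrite [t u v](family_sum j)// cmul_sumr (bigD1_seq w) ?steps_uniq//=.
rewrite (rel_mul rel)// ?term// big_seq_cond big1 ?addr0// => z /andP[zu zw].
rewrite -(rel_mul rel (u := dprod u z) (v := dprod u z)) ?term//.
by rewrite cmulA (step_orthogonal wu zu) ?cmul0l// eq_sym.
Qed.

(** Induction on the shape, starting from the fourth relation. Two distinct words of shape k + e_j
    have either distinct prefixes of shape k or a common prefix and distinct last steps. *)
Lemma same_shape_orthogonal u v : dshape u = dshape v -> u != v ->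
  t u u *c t v v = 0.
Proof.
move=> uv; have [k ku] : exists k, k = dshape u by exists (dshape u).
have k0 : zle 0 k by rewrite ku dshape_ge0.
move: k k0 u v ku uv; apply: zle0_ind => [u v u0 uv /eqP ne|k j k0 IH u v uk uv ne].
  by apply: (rel_orth rel); rewrite -?uv -?u0.
have [u' [w [u'k wj uw uE]]] := dword_factor k0 (zle0_delta j) (esym uk).
have [v' [z [v'k zj vz vE]]] := dword_factor k0 (zle0_delta j) (etrans (esym uv) (esym uk)).
have ws : w \in steps j (dterminus u') by apply/mem_steps.
have zs : z \in steps j (dterminus v') by apply/mem_steps.
have [e|ne'] := eqVneq u' v'.
  rewrite -e in zs vE; rewrite uE vE; apply: (step_orthogonal ws zs).
  by apply: contra ne => /eqP wz; rewrite uE vE wz.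
(* The projection onto u' w lies below that onto u', and likewise for v' z, so the vanishing product
   for u' and v' appears in the middle. *)
rewrite uE vE -(step_mul ws)// -[X in _ *c X](cstarK) (rel_star rel)// -(step_mul zs)//.
rewrite cstarM !(rel_star rel)// cmulA -(cmulA (t (dprod u' w) _)) IH ?cmul0r ?cmul0l//.
by rewrite u'k v'k.
Qed.

Lemma family_mul0 u v x y : dterminus u = dterminus v -> dterminus x = dterminus y ->
  dshape v = dshape x -> v != x -> t u v *c t x y = 0.
Proof.
move=> uv xy vx ne; rewrite -(rel_mul rel uv (erefl _)) -(rel_mul rel (erefl _) xy).
by rewrite cmulA -(cmulA (t u v)) same_shape_orthogonal// cmul0r cmul0l.
Qed.

Lemma family_mul u v x y : dterminus u = dterminus v -> dterminus x = dterminus y ->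
  dshape v = dshape x -> t u v *c t x y = if v == x then t u y else 0.
Proof.
move=> uv xy vx; case: eqVneq => [e|]; last exact: family_mul0.
by rewrite e in uv *; exact: (rel_mul rel).
Qed.

Lemma extension_mull u v w : dterminus u = origin w -> dterminus u = dterminus v ->
  t (dprod u w) (dprod u w) *c t u v = t (dprod u w) (dprod v w).
Proof.
have [k kw] : exists k, k = wshape w by exists (wshape w).
have k0 : zle 0 k by rewrite kw wshape_ge0.
move: k k0 w kw u v; apply: zle0_ind => [w w0 u v uw uv|k j k0 IH w wk u v uw uv].
  by rewrite !dprod_shape0 -?uv ?(rel_mul rel).
have [x [z [xk zj xz wE]]] := word_factor adm k0 (zle0_delta j) (esym wk).
have ux : dterminus u = origin x by rewrite uw wE origin_wprod.
have vx : dterminus v = origin x by rewrite -uv.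
have zs : z \in steps j (dterminus (dprod u x)).
  by apply/mem_steps; rewrite dterminus_dprod.
rewrite wE -!dprodA// -[in LHS](step_mul zs (erefl _)) -cmulA.
by rewrite IH// (step_mul zs)// !dterminus_dprod.
Qed.

End Family.

(* Iterating the third defining relation; the index set is the same for all
   families satisfying the relations. *)
Lemma refinement k (a : option A) : zle 0 k -> exists Z : seq (word M),
  (forall z, z \in Z -> wshape z = k /\ origin z = a) /\
  forall (R : realType) (B : cstarAlgType R) (t : dword -> dword -> B),
    defining_relations t -> forall u v, dterminus u = a -> dterminus v = a ->
    t u v = \sum_(z <- Z) t (dprod u z) (dprod v z).
Proof.
move: k; apply: zle0_ind => [|k j k0 [Z [ZE Zt]]].
  (* [None] is never a terminus, so the empty list serves vacuously. *)
  case: a => [a|]; last first.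
    by exists [::]; split=> // R B t _ u; have [b ->] := dterminus_in u.
  have [z [z0 za _]] := letter M a; exists [:: z]; split=> [y|].
    by rewrite inE => /eqP->.
  move=> R B t _ u v ua va; rewrite big_seq1 !dprod_shape0//; first by rewrite va.
  by rewrite ua.
exists [seq wprod z w | z <- Z, w <- steps j (terminus z)]; split=> [x|].
  case/allpairsPdep => z [y [/ZE[zk za] /mem_steps[yj yz] ->]].
  by rewrite wshape_wprod// zk yj origin_wprod.
move=> R B t rel u v ua va; rewrite big_allpairs_dep (Zt _ _ _ rel)//.
rewrite [LHS]big_seq [RHS]big_seq; apply: eq_bigr => z /ZE[zk za].
have uz : dterminus u = origin z by rewrite ua.
have vz : dterminus v = origin z by rewrite va.
rewrite (family_sum rel j) ?dterminus_dprod// [LHS]big_seq [RHS]big_seq.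
by apply: eq_bigr => y /mem_steps[yj yz]; rewrite !dprodA.
Qed.

Section Orthogonality.
Variables (R : realType) (B : cstarAlgType R) (t : dword -> dword -> B).
Hypothesis rel : defining_relations t.

(** Refining [u] by the shape of [v] and [v] by the shape of [u] brings both to the same shape,
    where distinct words are orthogonal. *)
Lemma incompatible_orthogonal u v :
  (forall w z, dterminus u = origin w -> dterminus v = origin z ->
     dprod u w <> dprod v z) -> t u u *c t v v = 0.
Proof.
move=> ne; have [Z [ZE Zt]] := refinement (dterminus u) (dshape_ge0 v).
have [Y [YE Yt]] := refinement (dterminus v) (dshape_ge0 u).
rewrite (Zt _ _ _ rel)// [X in _ *c X](Yt _ _ _ rel)// cmul_suml big_seq big1//.
move=> z /ZE[zs zo]; rewrite cmul_sumr big_seq big1// => y /YE[ys yo].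
apply: same_shape_orthogonal => //; last by apply/eqP/ne.
by rewrite !dshape_dprod// zs ys addrC.
Qed.

(** A common extension of u w and v w would contain [w] at the offsets [dshape u] and [dshape v],
    making their difference a period of [w]. *)
Lemma aperiodic_orthogonal u v w : dterminus u = origin w -> dterminus v = origin w ->
  ~ Defs.periodic (dshape v - dshape u) w ->
  t (dprod u w) (dprod u w) *c t (dprod v w) (dprod v w) = 0.
Proof.
move=> uw vw np; apply: incompatible_orthogonal => y z.
rewrite !dterminus_dprod// => wy wz /(congr1 (@dbase _ _ _ _ _)) /= e; apply: np.
apply: (@overlap_periodic _ _ _ w (wprod (wprod (dbase u) w) y)) => l lb.
  rewrite wmap_wprodl ?wmap_wprodr// ?terminus_wprod// wshape_wprod// addrC.
  by rewrite box_shift ?wshape_ge0.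
rewrite e wmap_wprodl ?wmap_wprodr// ?terminus_wprod// wshape_wprod// addrC.
by rewrite box_shift ?wshape_ge0.
Qed.

End Orthogonality.

End DecoratedWords.

(** * Formal sums of matrix units *)

Section FormalSums.
Variables (R : realType) (T : choiceType) (X Y : eqType).
Variables (tm : T -> X) (sh : T -> Y).
Local Notation C := R[i].
Local Notation fsum := (seq (C * (T * T))).

Definition fvalid (L : fsum) := forall x, x \in L -> tm x.2.1 = tm x.2.2.

(** Pairs with different inner indices are dropped; this computes the product in the algebra only
    when all inner indices have the same shape. *)
Definition fprod (L L' : fsum) : fsum :=
  [seq (x.1 * y.1, (x.2.1, y.2.2)) | x <- L, y <- [seq y <- L' | x.2.2 == y.2.1]].

Definition fstar (L : fsum) : fsum := [seq (x.1^*, (x.2.2, x.2.1)) | x <- L].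

Lemma fprodP L L' z : z \in fprod L L' -> exists x y,
  [/\ x \in L, y \in L', x.2.2 = y.2.1 & z = (x.1 * y.1, (x.2.1, y.2.2))].
Proof.
case/allpairsPdep => x [y [xL]]; rewrite mem_filter => /andP[/eqP xy yL] ->.
by exists x, y.
Qed.

Lemma fvalid_fprod L L' : fvalid L -> fvalid L' -> fvalid (fprod L L').
Proof. by move=> vL vL' z /fprodP[x [y [/vL + /vL' + e ->]]] /=; rewrite e => ->. Qed.

Lemma fvalid_fstar L : fvalid L -> fvalid (fstar L).
Proof. by move=> vL z /mapP[x /vL e ->]. Qed.

Section Evaluation.
Variable B : cstarAlgType R.

Definition ev (e : T -> T -> B) (L : fsum) : B :=
  \sum_(x <- L) x.1 *: e x.2.1 x.2.2.

(** The product rule is restricted to equal [sh], since words of different shapes may extend one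
    another. Units may vanish, as they do in the compressed families. *)
Definition matrix_units (e : T -> T -> B) :=
  (forall u v, tm u = tm v -> cstar (e u v) = e v u) /\
  (forall u v x y, tm u = tm v -> tm x = tm y -> sh v = sh x ->
     e u v *c e x y = if v == x then e u y else 0).

Variable (e : T -> T -> B).

Lemma ev_cat L L' : ev e (L ++ L') = ev e L + ev e L'.
Proof. by rewrite /ev big_cat. Qed.

Hypothesis mu : matrix_units e.

Lemma ev_fstar L : fvalid L -> ev e (fstar L) = cstar (ev e L).
Proof.
move=> vL; rewrite /ev big_map cstar_sum big_seq [RHS]big_seq.
by apply: eq_bigr => x /vL h; rewrite cstarZ mu.1.
Qed.

Lemma ev_fprod L L' : fvalid L -> fvalid L' ->
  (forall x y, x \in L -> y \in L' -> sh x.2.2 = sh y.2.1) ->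
  ev e (fprod L L') = ev e L *c ev e L'.
Proof.
move=> vL vL' sLL'; rewrite /ev big_allpairs_dep cmul_suml.
rewrite big_seq [RHS]big_seq; apply: eq_bigr => x xL.
rewrite cmul_sumr big_filter /= big_mkcond big_seq [RHS]big_seq.
apply: eq_bigr => y yL; rewrite cmulZl cmulZr scalerA.
rewrite (mu.2 _ _ _ _ (vL _ xL) (vL' _ yL) (sLL' _ _ xL yL)).
by case: ifP => //; rewrite scaler0.
Qed.

Lemma nrm_unit_sqr u v : tm u = tm v -> nrm (e u v) ^+ 2 = nrm (e v v).
Proof. by move=> uv; rewrite -nrmMstar mu.1// mu.2// eqxx. Qed.

Lemma unit_projection u : projection (e u u).
Proof. by split; [rewrite mu.1|rewrite mu.2// eqxx]. Qed.

Lemma nrm_unit_le1 u v : tm u = tm v -> nrm (e u v) <= 1.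
Proof.
move=> uv; have := nrm_unit_sqr uv.
have := nrm_projection_le (unit_projection v); have := nrm_ge0 (e u v).
by nra.
Qed.

Lemma nrm_unit1 u v : tm u = tm v -> e u v <> 0 -> nrm (e u v) = 1.
Proof.
move=> uv ne0; have := nrm_unit_sqr uv; have := nrm_projection (unit_projection v).
have n0 := nrm_ge0 (e u v).
case=> -> /eqP; last by rewrite sqrp_eq1// => /eqP.
by rewrite sqrf_eq0 => /eqP h; case: ne0; apply: nrm_le0; rewrite h.
Qed.

Definition coef (L : fsum) (p : T * T) : C := \sum_(x <- L | x.2 == p) x.1.

Lemma ev_coef (P : seq (T * T)) L : uniq P -> (forall x, x \in L -> x.2 \in P) ->
  ev e L = \sum_(p <- P) coef L p *: e p.1 p.2.
Proof.
move=> uP LP; rewrite /ev big_seq.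
transitivity (\sum_(x <- L | x \in L) \sum_(p <- P | x.2 == p) x.1 *: e p.1 p.2).
  apply: eq_bigr => x xL; rewrite big_mkcond (bigD1_seq x.2) ?LP//= eqxx big1 ?addr0//.
  by move=> p; rewrite eq_sym => /negbTE->.
rewrite -big_seq (exchange_big_dep xpredT)//=; apply: eq_bigr => p _.
by rewrite /coef scaler_suml.
Qed.

Lemma ev_compress u v L n : fvalid L -> sh u = n -> sh v = n ->
  (forall x, x \in L -> sh x.2.1 = n /\ sh x.2.2 = n) -> tm u = tm v ->
  e u u *c ev e L *c e v v = coef L (u, v) *: e u v.
Proof.
move=> vL un vn sL uv; rewrite /ev cmul_sumr cmul_suml /coef scaler_suml.
rewrite [RHS]big_mkcond [LHS]big_seq [RHS]big_seq; apply: eq_bigr => x xL.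
have [s1 s2] := sL _ xL; have tx := vL _ xL.
rewrite cmulZr cmulZl mu.2 ?un ?s1//.
case: (x.2) s1 s2 tx => [a b] /= s1 s2 tx; rewrite xpair_eqE eq_sym.
case: eqVneq => [e1|_] /=; last by rewrite cmul0l scaler0.
rewrite e1 in tx *; rewrite mu.2 ?s2 ?vn//.
by case: ifP => //; rewrite scaler0.
Qed.

Lemma nrm_coef_le (u v : T) L n : fvalid L -> sh u = n -> sh v = n ->
  (forall x, x \in L -> sh x.2.1 = n /\ sh x.2.2 = n) -> tm u = tm v ->
  e u v <> 0 -> complex.Re `|coef L (u, v)| <= nrm (ev e L).
Proof.
move=> vL un vn sL uv ne0; rewrite -[leLHS]mulr1 -(nrm_unit1 uv ne0) -nrmZ.
rewrite -(ev_compress vL un vn sL uv); apply: le_trans (nrmM _ _) _.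
apply: le_trans (_ : nrm (ev e L) * 1 <= _); last by rewrite mulr1.
apply: ler_pM; rewrite ?nrm_ge0 ?nrm_unit_le1//.
apply: le_trans (nrmM _ _) _; rewrite ler_piMl ?nrm_ge0// nrm_unit_le1//.
Qed.

End Evaluation.

Lemma ev_fprod_iter (B : cstarAlgType R) (e : T -> T -> B) (L : fsum) n k :
  matrix_units e -> fvalid L ->
  (forall x, x \in L -> sh x.2.1 = n /\ sh x.2.2 = n) ->
  ev e (iter k (fun G => fprod G G) L) = iter k (@sq _ B) (ev e L).
Proof.
move=> mu vL sL; pose G k := iter k (fun G => fprod G G) L.
have [vG sG] : (forall k, fvalid (G k)) /\
    (forall k x, x \in G k -> sh x.2.1 = n /\ sh x.2.2 = n).
  split=> j; elim: j => //= j IH; first exact: fvalid_fprod.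
  by move=> z /fprodP[x [y [/IH[x1 _] /IH[_ y2] _ ->]]].
elim: k => //= k IH; rewrite ev_fprod ?IH//.
  exact: vG.
exact: vG.
by move=> x y /sG[_ ->] /sG[-> _].
Qed.

(* Two C*-norms on a finite-dimensional algebra agree: they are equivalent, and
   the C*-identity turns the equivalence constants into their [2^k]-th roots. *)
Lemma matrix_units_dominated (B B' : cstarAlgType R) (e : T -> T -> B)
    (f : X -> T -> T -> B') (L : fsum) (m n : Y) (N : R) :
  matrix_units e -> (forall a, matrix_units (f a)) ->
  (forall u v, tm u = tm v -> f (tm u) u v <> 0) ->
  fvalid L -> (forall x, x \in L -> sh x.2.1 = m /\ sh x.2.2 = n) ->
  0 <= N -> (forall a, nrm (ev (f a) L) <= N) -> nrm (ev e L) <= N.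
Proof.
move=> mue muf nzf vL sL N0 hN.
(* [L] is a rectangular block, from shape [n] to shape [m]; L^* L is square and can be iterated. *)
pose G0 := fprod (fstar L) L.
have vG0 : fvalid G0 by apply: fvalid_fprod => //; exact: fvalid_fstar.
have ssL x y : x \in fstar L -> y \in L -> sh x.2.2 = sh y.2.1.
  by move=> /mapP[z /sL[zm _] ->] /sL[ym _]; rewrite /= zm ym.
have sG0 x : x \in G0 -> sh x.2.1 = n /\ sh x.2.2 = n.
  by move=> /fprodP[y [z [/mapP[y' /sL[_ h] ->] /sL[_ h'] _ ->]]].
have evG0 (B1 : cstarAlgType R) (g : T -> T -> B1) : matrix_units g ->
    ev g G0 = cstar (ev g L) *c ev g L.
  by move=> mug; rewrite ev_fprod ?ev_fstar//; exact: fvalid_fstar.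
pose V := undup [seq x.2.2 | x <- L]; pose P := [seq (u, v) | u <- V, v <- V].
have uP : uniq P by apply: allpairs_uniq; rewrite ?undup_uniq// => -[? ?] [? ?].
pose G k := iter k (fun G => fprod G G) G0.
have vG k : fvalid (G k) by elim: k => //= k IH; exact: fvalid_fprod.
have sG k x : x \in G k -> sh x.2.1 = n /\ sh x.2.2 = n.
  by elim: k x => //= k IH x /fprodP[y [z [/IH[h _] /IH[_ h'] _ ->]]].
have GP k x : x \in G k -> x.2 \in P.
  elim: k x => [|k IH] x /=.
    move=> /fprodP[y [z [/mapP[y' yL ->] zL _ ->]]] /=.
    by rewrite allpairs_f// mem_undup; apply/mapP; [exists y'|exists z].
  move=> /fprodP[y [z [/IH/allpairsP[[a b] [aV _ ey]] /IH/allpairsP[[c d] [_ dV ez]] _ ->]]].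
  by rewrite /= ey ez allpairs_f.
suff : nrm (cstar (ev e L) *c ev e L) <= N ^+ 2.
  by rewrite nrmMstar ler_pXn2r// nnegrE nrm_ge0.
(* Products create no index pairs outside [P], so the factor [size P] is constant in [k] and degree
   0 suffices. *)
apply: (@power_trick _ _ _ (size P)%:R 0 0); rewrite ?nrm_ge0 ?exprn_ge0// => k.
rewrite expn0 mulr1 -nrm_iter_sq; last by rewrite cstarM cstarK.
rewrite -evG0// -(ev_fprod_iter k mue vG0 sG0) -/(G k).
rewrite (ev_coef e uP (GP k)); apply: le_trans (nrm_sum _ _ _) _.
rewrite -sum1_size natr_sum mulr_suml big_seq [leRHS]big_seq; apply: ler_sum.
move=> [u v] /allpairsP[[u' v'] [/= uV vV [-> ->]]] {u v}.
have shV w : w \in V -> sh w = n.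
  by rewrite mem_undup => /mapP[x /sL[_ <-] ->].
have [uv|uv] := eqVneq (tm u') (tm v'); last first.
  rewrite /coef big_seq_cond big1 ?scale0r ?nrm0 ?mul1r ?exprn_ge0//.
  by move=> x /andP[/vG + /eqP e1]; rewrite e1 /= => h; rewrite h eqxx in uv.
rewrite mul1r nrmZ; apply: (@le_trans _ _ (complex.Re `|coef (G k) (u', v')| * 1)).
  apply: ler_wpM2l; last exact: nrm_unit_le1 mue _ _ uv.
  by have := normr_ge0 (coef (G k) (u', v')); rewrite lecE => /andP[].
(* Among the families [f], the one at [tm u'] is known to have a nonzero unit at (u', v'), so it
   detects this coefficient. *)
rewrite mulr1; apply: (@le_trans _ _ (nrm (ev (f (tm u')) (G k)))).
  by apply: (nrm_coef_le (muf _) (vG k) (shV _ uV) (shV _ vV) (sG k) uv); exact: nzf.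
rewrite (ev_fprod_iter k (muf _) vG0 sG0) evG0//.
apply: le_trans (nrm_iter_sq_le _ _) _; rewrite nrmMstar.
by rewrite !lerXn2r ?nnegrE ?exprn_ge0 ?nrm_ge0.
Qed.

End FormalSums.

(** * The key estimate *)

Lemma sum_projection (R : realType) (B : cstarAlgType R) (T : eqType) (s : seq T)
    (p : T -> B) : uniq s -> (forall i, i \in s -> projection (p i)) ->
  (forall i j, i \in s -> j \in s -> i != j -> p i *c p j = 0) ->
  projection (\sum_(i <- s) p i).
Proof.
move=> us ps orth; split.
  by rewrite cstar_sum big_seq [RHS]big_seq; apply: eq_bigr => i /ps[].
rewrite cmul_suml big_seq [RHS]big_seq; apply: eq_bigr => i is_.
rewrite cmul_sumr (bigD1_seq i)//= (ps _ is_).2 big_seq_cond big1 ?addr0//.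
by move=> j /andP[js ji]; rewrite orth// eq_sym.
Qed.

Section KeyEstimate.
Variables (R : realType) (r : nat) (A : finType) (M : 'I_r -> A -> A -> int).
Hypothesis adm : admissible M.
Variables (D : Type) (delta : D -> A).
Local Notation shape := 'rV[int]_r.
Local Notation dword := (dword M delta).
Local Notation term := (R[i] * (dword * dword))%type.
Local Notation fsum := (seq term).
Local Notation valid := (fvalid (@dterminus r A M D delta)).
Implicit Types (L : fsum) (x : term).

Definition deg x : shape := dshape x.2.1 - dshape x.2.2.

Definition part (p : pred shape) L := [seq x <- L | p (deg x)].

Lemma family_matrix_units (B : cstarAlgType R) (t : dword -> dword -> B) :
  defining_relations t -> matrix_units (@dterminus r A M D delta) (@dshape r A M D delta) t.
Proof.
by move=> rel; split=> [u v|u v x y]; [exact: (rel_star rel)|exact: (family_mul adm rel)].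
Qed.

(** The amount [kf] may vary from term to term, because refining a term changes neither its value
    nor its degree. [L'] is chosen before the family, so one refinement serves both families at
    once. *)
Lemma fsum_refinement (kf : term -> shape) L : valid L ->
  (forall x, x \in L -> zle 0 (kf x)) ->
  exists L', [/\ valid L',
    forall y, y \in L' -> exists2 x, x \in L &
      dshape y.2.1 = dshape x.2.1 + kf x /\ dshape y.2.2 = dshape x.2.2 + kf x &
    forall (B : cstarAlgType R) (t : dword -> dword -> B), defining_relations t ->
      forall p, ev t (part p L') = ev t (part p L)].
Proof.
elim: L => [_ _|x L IH vL kL].
  by exists [::]; split.
have [||L' [vL' sL' eL']] := IH.
- by move=> y yL; apply: vL; rewrite inE yL orbT.
- by move=> y yL; apply: kL; rewrite inE yL orbT.
have xv : dterminus x.2.1 = dterminus x.2.2 by apply: vL; rewrite inE eqxx.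
have x0 : zle 0 (kf x) by apply: kL; rewrite inE eqxx.
have [Z [ZE Zt]] := refinement adm delta (dterminus x.2.1) x0.
pose Lx : fsum := [seq (x.1, (dprod x.2.1 z, dprod x.2.2 z)) | z <- Z].
have sLx y : y \in Lx -> dshape y.2.1 = dshape x.2.1 + kf x /\
    dshape y.2.2 = dshape x.2.2 + kf x.
  by move=> /mapP[z /ZE[zs zo] ->] /=; rewrite !dshape_dprod ?zs// -xv.
exists (Lx ++ L'); split=> [y|y|B t rel p].
- rewrite mem_cat => /orP[/mapP[z /ZE[zs zo] ->]|/vL'//] /=.
  by rewrite !dterminus_dprod// -xv.
- rewrite mem_cat => /orP[/sLx h|/sL'[x' x'L h]].
    by exists x; rewrite ?inE ?eqxx.
  by exists x'; rewrite ?inE ?x'L ?orbT.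
rewrite /part filter_cat ev_cat -/(part p L') eL'//=.
have degx y : y \in Lx -> deg y = deg x.
  by move=> /sLx[h1 h2]; rewrite /deg h1 h2 opprD addrACA subrr addr0.
have -> : ev t (if p (deg x) then x :: part p L else part p L) =
    (if p (deg x) then x.1 *: t x.2.1 x.2.2 else 0) + ev t (part p L).
  by case: ifP => _; rewrite ?add0r// /ev big_cons.
congr (_ + _); rewrite /ev big_filter big_mkcond.
under eq_big_seq => y yL do rewrite degx//.
case: ifP => _; last by rewrite big1.
rewrite big_map /= -scaler_sumr; congr (_ *: _).
by rewrite -(Zt _ _ _ rel).
Qed.

Lemma shapes_bounded L : exists m, forall x, x \in L ->
  zle (dshape x.2.1) m /\ zle (dshape x.2.2) m.
Proof.
elim: L => [|x L [m IH]]; first by exists 0.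
have m1 := dshape_ge0 x.2.1; have m2 := dshape_ge0 x.2.2.
have [m0 [m00 mm0]] : exists m0, zle 0 m0 /\ zle m m0.
  exists (\row_i `|m 0 i|); split; apply/zleP => i; rewrite !mxE ?normr_ge0//.
  exact: ler_norm.
exists (dshape x.2.1 + dshape x.2.2 + m0) => y.
rewrite inE => /orP[/eqP->|/IH[h1 h2]]; split.
- by rewrite -addrA zle_addr// zle0_add.
- by rewrite addrAC addrC zle_addr// zle0_add.
- by apply: (zle_trans h1); apply: (zle_trans mm0); rewrite addrC zle_addr// zle0_add.
- by apply: (zle_trans h2); apply: (zle_trans mm0); rewrite addrC zle_addr// zle0_add.
Qed.

Section TwoFamilies.
Variables (B B' : cstarAlgType R).
Variables (s : dword -> dword -> B) (S : dword -> dword -> B').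
Hypothesis (s_rel : defining_relations s) (S_rel : defining_relations S).
Hypothesis S_neq0 : forall u v, dterminus u = dterminus v -> S u v <> 0.

Section Compression.
Variables (W : A -> word M).
Hypothesis WE : forall a, origin (W a) = Some a.

(** One terminal letter at a time: [aperiodic_orthogonal] compares two copies of one word, and says
    nothing about overlaps of w_a with another w_b. *)
Definition extended (a : option A) (u v : dword) : B' :=
  if a is Some b then
    if dterminus u == a then S (dprod u (W b)) (dprod v (W b)) else 0
  else 0.

Lemma extended_units a :
  matrix_units (@dterminus r A M D delta) (@dshape r A M D delta) (extended a).
Proof.
case: a => [a|]; last first.
  by split=> *; rewrite /= ?cstar0// cmul0l; case: ifP.
split=> [u v uv|u v x y uv xy vx] /=.
  rewrite -uv; case: eqP => [ua|_]; last by rewrite cstar0.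
  by rewrite (rel_star S_rel)// !dterminus_dprod// ?WE// -uv.
case: eqVneq => [ua|ua]; last first.
  by rewrite cmul0l; case: ifP.
have va : dterminus v = Some a by rewrite -uv.
case: (eqVneq v x) => [e|ne].
  rewrite -e va eqxx (rel_mul S_rel) ?dterminus_dprod ?WE// -xy -e//.
case: eqVneq => [xa|_]; last by rewrite cmul0r.
have ya : dterminus y = Some a by rewrite -xy.
apply: (family_mul0 adm S_rel); rewrite ?dterminus_dprod ?WE//.
  by rewrite !dshape_dprod ?WE// vx.
apply: contra ne => /eqP /(dprod_inj adm vx) h.
by have [||->] := h; rewrite ?WE.
Qed.

Lemma extended_neq0 u v : dterminus u = dterminus v -> extended (dterminus u) u v <> 0.
Proof.
move=> uv; have [a ua] := dterminus_in u; rewrite /extended ua eqxx.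
by apply: S_neq0; rewrite !dterminus_dprod// ?WE// -uv.
Qed.

(* Compression by the projections onto the words [u w_a] kills every term of
   degree other than [d], because two copies of the aperiodic word [w_a] cannot
   be shifted against each other. *)
Lemma compression_bound L d m a : valid L ->
  (forall x, x \in L -> dshape x.2.1 = m) ->
  (forall x a, x \in L -> deg x != d -> ~ Defs.periodic (deg x - d) (W a)) ->
  nrm (ev (extended a) (part (pred1 d) L)) <= nrm (ev S L).
Proof.
move=> vL sL np; case: a => [a|]; last first.
  by rewrite /ev /extended big1 ?nrm0 ?nrm_ge0// => *; rewrite scaler0.
set w := W a; have wa : origin w = Some a := WE a.
pose U := undup [seq x.2.1 | x <- L & dterminus x.2.1 == Some a].
pose V := undup [seq x.2.2 | x <- part (pred1 d) L & dterminus x.2.2 == Some a].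
pose pS u := S (dprod u w) (dprod u w).
have UP u : u \in U -> dterminus u = Some a /\ dshape u = m.
  rewrite mem_undup => /mapP[x]; rewrite mem_filter => /andP[/eqP xa xL] ->.
  by rewrite sL.
have degE x : x \in L -> dshape x.2.2 = m - deg x.
  by move=> /sL xm; rewrite /deg xm opprB addrC subrK.
have VP v : v \in V -> dterminus v = Some a /\ dshape v = m - d.
  rewrite mem_undup => /mapP[x]; rewrite !mem_filter => /and3P[/eqP xa /eqP xd xL] ->.
  by rewrite degE// xd.
have orth n u v : dterminus u = Some a -> dshape u = n -> dterminus v = Some a ->
    dshape v = n -> u != v -> pS u *c pS v = 0.
  move=> ua un va vn ne; apply: (family_mul0 adm S_rel) => //.
    by rewrite !dshape_dprod ?wa// un vn.
  by apply: contra ne => /eqP /(dprod_inj adm (etrans un (esym vn))) h;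
    have [||->] := h; rewrite ?wa.
pose Q := \sum_(u <- U) pS u; pose Q' := \sum_(v <- V) pS v.
have prj u : projection (pS u) := family_projection S_rel (dprod u w).
have Qp : projection Q.
  apply: sum_projection => [|u _|u v /UP[ua um] /UP[va vm]]; rewrite ?undup_uniq//.
  exact: (orth m).
have Q'p : projection Q'.
  apply: sum_projection => [|u _|u v /VP[ua um] /VP[va vm]]; rewrite ?undup_uniq//.
  exact: (orth (m - d)).
(* [Q] and [Q'] are sums of orthogonal projections, hence projections, and multiplying by them does
   not increase the norm. *)
suff -> : ev (extended (Some a)) (part (pred1 d) L) = Q *c ev S L *c Q'.
  apply: le_trans (nrmM _ _) _; apply: (@le_trans _ _ (nrm (Q *c ev S L) * 1)).
    by apply: ler_wpM2l; rewrite ?nrm_ge0 ?nrm_projection_le.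
  rewrite mulr1; apply: le_trans (nrmM _ _) _.
  by rewrite ler_piMl ?nrm_ge0 ?nrm_projection_le.
rewrite /ev /part big_filter big_mkcond [Q *c _]cmul_sumr [_ *c Q']cmul_suml big_seq [RHS]big_seq.
apply: eq_bigr => x xL; rewrite cmulZr cmulZl /=.
have xv := vL _ xL; have xm := sL _ xL.
have cut u1 : u1 \in U -> u1 != x.2.1 -> pS u1 *c S x.2.1 x.2.2 = 0.
  move=> /UP[u1a u1m] ne.
  have -> : pS u1 = pS u1 *c S u1 u1.
    by rewrite (extension_mull adm S_rel) ?u1a.
  by rewrite -cmulA (family_mul0 adm S_rel) ?cmul0r// u1m.
case: (eqVneq (dterminus x.2.1) (Some a)) => [xa|xa]; last first.
  rewrite scaler0 if_same /Q cmul_suml big_seq big1 ?cmul0l ?scaler0// => u1 u1U.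
  apply: cut => //; apply: contra xa => /eqP <-; by rewrite (UP _ u1U).1.
have va : dterminus x.2.2 = Some a by rewrite -xv.
have xU : x.2.1 \in U.
  by rewrite mem_undup; apply/mapP; exists x; rewrite ?mem_filter ?xa ?eqxx.
have -> : Q *c S x.2.1 x.2.2 = S (dprod x.2.1 w) (dprod x.2.2 w).
  rewrite /Q cmul_suml (bigD1_seq x.2.1) ?undup_uniq//= big_seq_cond big1 ?addr0.
    by rewrite /pS (extension_mull adm S_rel) ?xa.
  by move=> u1 /andP[u1U ne]; exact: cut.
rewrite -(rel_mul S_rel (u := dprod x.2.1 w) (v := dprod x.2.2 w))
  ?dterminus_dprod ?xa ?va ?wa// -cmulA /Q' cmul_sumr.
case: (eqVneq (deg x) d) => [xd|xd].
  have xV : x.2.2 \in V.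
    by rewrite mem_undup; apply/mapP; exists x; rewrite ?mem_filter ?va ?eqxx//= xd eqxx xL.
  rewrite (bigD1_seq x.2.2) ?undup_uniq//= big_seq_cond big1 ?addr0.
    by rewrite (prj _).2 (rel_mul S_rel) ?dterminus_dprod ?xa ?va ?wa.
  move=> v1 /andP[/VP[v1a v1m] ne]; apply: (orth (m - d)) => //; last by rewrite eq_sym.
  by rewrite degE// xd.
(* The shapes of [v1] and of the second index of [x] differ by [deg x - d], a period excluded for
   [W a]. *)
rewrite big_seq big1 ?cmul0r ?scaler0// => v1 /VP[v1a v1m].
apply: (aperiodic_orthogonal adm S_rel); rewrite ?v1a ?va ?wa//.
by rewrite v1m degE// subrBB subrr sub0r opprB; exact: np.
Qed.

End Compression.

Lemma part_bound L d : valid L -> nrm (ev s (part (pred1 d) L)) <= nrm (ev S L).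
Proof.
move=> vL0; have [m mL] := shapes_bounded L.
have [|L' [vL' sL' eL']] := @fsum_refinement (fun x => m - dshape x.2.1) L vL0.
  by move=> x /mL[h _]; rewrite -zle_sub.
have {}sL' x : x \in L' -> dshape x.2.1 = m.
  by move=> /sL'[y _ [-> _]]; rewrite addrC subrK.
rewrite -eL'//; have -> : ev S L = ev S L'.
  by have := eL' _ _ S_rel predT; rewrite /part !filter_predT.
pose P := [seq deg x - d | x <- L' & deg x != d].
have P0 : 0 \notin P.
  apply/mapP => -[x]; rewrite mem_filter => /andP[xd _] /esym/eqP.
  by rewrite subr_eq0 (negbTE xd).
have [W WP] : exists W : A -> word M, forall a, origin (W a) = Some a /\
    forall p, p \in P -> ~ Defs.periodic p (W a).
  pose Pa (a : A) (w : word M) := origin w = Some a /\ forall p, p \in P -> ~ Defs.periodic p w.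
  suff /choice[W WP] : forall a, exists w, Pa a w by exists W.
  move=> a.
  by have [w wa wP] := aperiodic_word adm a P0; exists w.
have WE a : origin (W a) = Some a by have [] := WP a.
(* All first indices have shape [m], so degree [d] forces the second ones to have shape [m - d]: the
   part is a single block. *)
apply: (@matrix_units_dominated _ _ _ _ _ _ _ _ s (extended W) _ m (m - d)).
- exact: family_matrix_units.
- exact: extended_units.
- exact: extended_neq0.
- by move=> x; rewrite mem_filter => /andP[_ /vL'].
- move=> x; rewrite mem_filter => /andP[/eqP xd xL]; rewrite sL'//; split=> //.
  by rewrite -xd /deg sL'// opprB addrC subrK.
- exact: nrm_ge0.
move=> a; apply: (compression_bound WE (m := m)) => // x b xL xd.
have [_] := WP b; apply; apply/mapP; exists x => //.
by rewrite mem_filter xd.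
Qed.

End TwoFamilies.

Definition deg_bounded (K : nat) L :=
  forall x i, x \in L -> `|deg x 0 i| <= K%:Z.

Lemma deg_bounded_ex L : exists K, deg_bounded K L.
Proof.
elim: L => [|x L [K IH]]; first by exists 0.
exists (\sum_i `|deg x ord0 i| + K)%N => y i; rewrite inE => /orP[/eqP->|/IH h].
  have : (`|deg x ord0 i| <= \sum_i `|deg x ord0 i|)%N by rewrite (bigD1 i)//= leq_addr.
  by rewrite -[ord0]/(0 : 'I_1); lia.
have := h i; lia.
Qed.

(** Refining the second indices of [L] and the first indices of [L'] to a common shape makes [fprod]
    applicable. Degrees add, so their bound grows only linearly in the number of factors. *)
Lemma fsum_product L L' K K' : valid L -> valid L' ->
  deg_bounded K L -> deg_bounded K' L' -> exists P, [/\ valid P, deg_bounded (K + K') P &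
    forall (B : cstarAlgType R) (t : dword -> dword -> B), defining_relations t ->
      ev t P = ev t L *c ev t L'].
Proof.
move=> vL vL' bL bL'; have [m mL] := shapes_bounded (L ++ L').
have [|L1 [vL1 sL1 eL1]] := @fsum_refinement (fun x => m - dshape x.2.2) L vL.
  by move=> x xL; rewrite -zle_sub; have [] := mL x; rewrite ?mem_cat ?xL.
have [|L2 [vL2 sL2 eL2]] := @fsum_refinement (fun x => m - dshape x.2.1) L' vL'.
  by move=> x xL; rewrite -zle_sub; have [] := mL x; rewrite ?mem_cat ?xL ?orbT.
exists (fprod L1 L2); split=> [||B t rel].
- exact: fvalid_fprod.
- move=> z i /fprodP[x [y [/sL1[x' x'L [h1 h2]] /sL2[y' y'L [h3 h4]] xy ->]]].
  have -> : deg (x.1 * y.1, (x.2.1, y.2.2)) = deg x' + deg y'.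
    by rewrite /deg /= h1 h4; apply/rowP => k; rewrite !mxE; ring.
  have := bL _ i x'L; have := bL' _ i y'L.
  have -> : (deg x' + deg y') 0 i = deg x' 0 i + deg y' 0 i by rewrite [LHS]mxE.
  lia.
have <- : ev t L1 = ev t L by have := eL1 _ _ rel predT; rewrite /part !filter_predT.
have <- : ev t L2 = ev t L' by have := eL2 _ _ rel predT; rewrite /part !filter_predT.
apply: (ev_fprod (family_matrix_units rel)) => // x y.
by move=> /sL1[x' _ [_ ->]] /sL2[y' _ [-> _]]; rewrite addrC subrK addrC subrK.
Qed.

Lemma size_degrees (ds : seq shape) (K : nat) : uniq ds ->
  (forall d i, d \in ds -> `|d 0 i| <= K%:Z) -> (size ds <= (2 * K + 1) ^ r)%N.
Proof.
move=> uds bds; pose f (d : shape) : {ffun 'I_r -> 'I_(2 * K).+1} :=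
  [ffun i => inord (absz (d 0 i + K%:Z))].
have rng (a : int) : `|a| <= K%:Z -> (absz (a + K%:Z)%R < (2 * K).+1)%N.
  rewrite ler_norml => /andP[a1 a2]; rewrite ltnS -lez_nat gez0_abs; lia.
have f_inj : {in ds &, injective f}.
  move=> d d' /bds bd /bds bd' /ffunP ff; apply/rowP => i.
  have := congr1 val (ff i); rewrite !ffunE /=.
  rewrite !inordK ?rng//; move: (d 0 i) (d' 0 i) (bd i) (bd' i) => a b.
  by rewrite !ler_norml => /andP[a1 a2] /andP[b1 b2]; lia.
rewrite -(size_map f) addn1; have /card_uniqP <- : uniq (map f ds) by rewrite map_inj_in_uniq.
by apply: leq_trans (max_card _) _; rewrite card_ffun !card_ord.
Qed.

Lemma deg_partition (B : cstarAlgType R) (t : dword -> dword -> B) L :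
  ev t L = \sum_(d <- undup [seq deg x | x <- L]) ev t (part (pred1 d) L).
Proof.
rewrite /ev; under [RHS]eq_bigr do rewrite /part big_filter.
rewrite (exchange_big_dep xpredT)//= big_seq [RHS]big_seq; apply: eq_bigr => x xL.
rewrite [RHS]big_mkcond (bigD1_seq (deg x)) ?undup_uniq ?mem_undup ?map_f//= eqxx.
by rewrite big1 ?addr0// => d; rewrite eq_sym => /negbTE->.
Qed.

Section Domination.
Variables (B B' : cstarAlgType R).
Variables (s : dword -> dword -> B) (S : dword -> dword -> B').
Hypothesis (s_rel : defining_relations s) (S_rel : defining_relations S).
Hypothesis S_neq0 : forall u v, dterminus u = dterminus v -> S u v <> 0.

(* A [2^k]-th power has at most polynomially many homogeneous parts in [2^k],
   so that [part_bound] improves to an estimate without multiplicity. *)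
Lemma families_dominated L : valid L -> nrm (ev s L) <= nrm (ev S L).
Proof.
move=> vL; have [K bL] := deg_bounded_ex L.
have vsL := fvalid_fstar vL.
have bsL : deg_bounded K (fstar L).
  move=> _ i /mapP[x xL ->]; have := bL _ i xL.
  by rewrite -normrN; congr (`|_| <= _); rewrite !mxE opprB.
have [G0 [vG0 bG0 eG0]] := fsum_product vsL vL bsL bL.
set K0 := (K + K)%N in bG0.
have it k : exists G, [/\ valid G, deg_bounded (K0 * 2 ^ k) G &
    forall (C : cstarAlgType R) (t : dword -> dword -> C), defining_relations t ->
      ev t G = iter k (@sq _ C) (cstar (ev t L) *c ev t L)].
  elim: k => [|k [G [vG bG eG]]].
    exists G0; rewrite muln1; split=> // C t rel.
    by rewrite eG0// (ev_fstar (family_matrix_units rel) vL).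
  have [P [vP bP eP]] := fsum_product vG vG bG bG; exists P; split=> //.
    by rewrite expnS mulnCA mul2n -addnn.
  by move=> C t rel; rewrite eP// !eG.
suff : nrm (cstar (ev s L) *c ev s L) <= nrm (cstar (ev S L) *c ev S L).
  by rewrite !nrmMstar ler_pXn2r// nnegrE nrm_ge0.
(* The coordinates of the degrees in the 2^k-th power lie between -K0 2^k and K0 2^k, leaving at
   most (2 K0 2^k + 1)^r degrees. *)
apply: (@power_trick _ _ _ 1 (2 * K0) r); rewrite ?nrm_ge0// => k.
have [G [vG bG eG]] := it k.
rewrite mul1r -nrm_iter_sq; last by rewrite cstarM cstarK.
rewrite -eG// deg_partition; apply: le_trans (nrm_sum _ _ _) _.
apply: (@le_trans _ _ (\sum_(d <- undup [seq deg x | x <- G]) nrm (ev S G))).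
  by apply: ler_sum => d _; exact: part_bound.
rewrite big_const_seq count_predT iter_addr_0 -[leLHS]mulr_natl.
apply: ler_pM; rewrite ?ler0n ?nrm_ge0//.
  rewrite ler_nat -mulnA; apply: size_degrees; first exact: undup_uniq.
  by move=> d i; rewrite mem_undup => /mapP[x xG ->]; exact: bG.
by rewrite eG// nrm_iter_sq_le.
Qed.

End Domination.

End KeyEstimate.

(** * Density and closed range *)

Section StarHom.
Variables (R : realType) (B B' : cstarAlgType R) (phi : B -> B').
Hypothesis hphi : star_hom phi.

Lemma star_homD x y : phi (x + y) = phi x + phi y.
Proof. by have [lin _ _] := hphi; have := lin 1 x y; rewrite !scale1r. Qed.

Lemma star_hom0 : phi 0 = 0.
Proof. by apply: (addrI (phi 0)); rewrite -star_homD !addr0. Qed.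

Lemma star_homZ a x : phi (a *: x) = a *: phi x.
Proof. by have [lin _ _] := hphi; have := lin a x 0; rewrite star_hom0 !addr0. Qed.

Lemma star_homB x y : phi (x - y) = phi x - phi y.
Proof. by rewrite -[- y]scaleN1r star_homD star_homZ scaleN1r. Qed.

Lemma star_hom_sum (I : Type) (s : seq I) (F : I -> B) :
  phi (\sum_(i <- s) F i) = \sum_(i <- s) phi (F i).
Proof. exact: (big_morph _ star_homD star_hom0). Qed.

Lemma star_subalgebra_range : star_subalgebra (range phi).
Proof.
have [lin mul st] := hphi; split.
- by exists 0 => //; exact: star_hom0.
- by move=> a _ _ [x _ <-] [y _ <-]; exists (a *: x + y) => //; exact: lin.
- by move=> _ _ [x _ <-] [y _ <-]; exists (x *c y) => //; exact: mul.
- by move=> _ [x _ <-]; exists (cstar x) => //; exact: st.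
Qed.

Lemma star_subalgebra_preimage X : star_subalgebra X -> star_subalgebra (phi @^-1` X).
Proof.
move=> [X0 XL XM XS]; have [lin mul st] := hphi; split=> /=.
- by rewrite star_hom0.
- by move=> a x y Xx Xy; rewrite lin; exact: XL.
- by move=> x y Xx Xy; rewrite mul; exact: XM.
- by move=> x Xx; rewrite st; exact: XS.
Qed.

Lemma closed_preimage X : (forall x, nrm (phi x) <= nrm x) -> closed X ->
  closed (phi @^-1` X).
Proof.
move=> le clX l /closure_nrm cl; apply: (closed_limit clX) => e /cl[x Xx lx].
by exists (phi x) => //; rewrite -star_homB (le_lt_trans (le _)).
Qed.

Lemma closed_range : (forall x, nrm (phi x) = nrm x) -> closed (range phi).
Proof.
move=> iso l /closure_nrm cl.
have /choice[u uP] : forall n : nat, exists x, nrm (l - phi x) < n.+1%:R^-1.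
  move=> n; have [|_ [x _ <-] lx] := cl n.+1%:R^-1; first by rewrite invr_gt0.
  by exists x.
have small (e : R) : 0 < e -> exists N, forall n, (N <= n)%N -> nrm (l - phi (u n)) < e.
  move=> e0; exists (Num.bound e^-1) => n Nn; apply: lt_trans (uP n) _.
  rewrite invf_plt ?posrE//; apply: lt_le_trans (archi_boundP _) _.
    by rewrite invr_ge0 ltW.
  by rewrite ler_nat ltnW.
have [|x xP] := @complete_nrm _ _ u.
  move=> e e0; have [N hN] := small _ (divr_gt0 e0 (ltr0n _ 2)).
  exists N => n Nn; rewrite -iso star_homB.
  apply: le_lt_trans (nrm_tri l _ _) _; rewrite nrm_distC [e]splitr.
  by rewrite ltrD ?hN.
exists x => //; apply/esym/subr0_eq/nrm_eps => e e0.
have [N hN] := small _ (divr_gt0 e0 (ltr0n _ 2)).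
have [N' hN'] := xP _ (divr_gt0 e0 (ltr0n _ 2)).
apply: le_trans (nrm_tri (phi (u (maxn N N'))) _ _) _; rewrite [e]splitr.
rewrite -star_homB iso [nrm (_ - x)]nrm_distC.
by apply: lerD; apply: ltW; [apply: hN; exact: leq_maxl|apply: hN'; exact: leq_maxr].
Qed.

End StarHom.

Lemma star_subalgebra_closure (R : realType) (B : cstarAlgType R) (X : set B) :
  star_subalgebra X -> star_subalgebra (closure X).
Proof.
move=> [X0 XL XM XS]; split; first exact: subset_closure.
- move=> a x y /closure_nrm cx /closure_nrm cy; apply/closure_nrm => e e0.
  set c := complex.Re `|a|.
  have c0 : 0 <= c by have := normr_ge0 a; rewrite lecE => /andP[].
  have e1 : 0 < e / (c + 1) by rewrite divr_gt0// ltr_wpDl.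
  have [x' Xx' xx'] := cx _ (divr_gt0 e1 (ltr0n _ 2)).
  have [y' Xy' yy'] := cy _ (divr_gt0 e0 (ltr0n _ 2)).
  exists (a *: x' + y'); first exact: XL.
  rewrite opprD addrACA -scalerBr; apply: le_lt_trans (nrmD _ _) _.
  rewrite nrmZ -/c [e]splitr ltr_leD//; last exact: ltW.
  have cc : 0 < c + 1 by rewrite ltr_wpDl.
  apply: (@le_lt_trans _ _ ((c + 1) * nrm (x - x'))).
    by rewrite ler_wpM2r ?nrm_ge0// lerDl.
  by rewrite mulrC -ltr_pdivlMr// mulrAC.
- move=> x y /closure_nrm cx /closure_nrm cy; apply/closure_nrm => e e0.
  have y1 : 0 < nrm y + 1 by rewrite ltr_wpDl ?nrm_ge0.
  have [x' Xx' xx'] := cx _ (divr_gt0 (divr_gt0 e0 (ltr0n _ 2)) y1).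
  (* The tolerance for [y'] is fixed after [x'], since the error x' (y - y') involves the norm of
     [x']. *)
  have x1 : 0 < nrm x' + 1 by rewrite ltr_wpDl ?nrm_ge0.
  have [y' Xy' yy'] := cy _ (divr_gt0 (divr_gt0 e0 (ltr0n _ 2)) x1).
  exists (x' *c y'); first exact: XM.
  have -> : x *c y - x' *c y' = (x - x') *c y + x' *c (y - y').
    by rewrite cmulBl cmulBr addrA subrK.
  apply: le_lt_trans (nrmD _ _) _; rewrite [e]splitr; apply: ltrD.
    apply: le_lt_trans (nrmM _ _) _.
    apply: (@le_lt_trans _ _ (nrm (x - x') * (nrm y + 1))).
      by rewrite ler_wpM2l ?nrm_ge0// lerDl.
    by rewrite -ltr_pdivlMr.
  apply: le_lt_trans (nrmM _ _) _.
  apply: (@le_lt_trans _ _ ((nrm x' + 1) * nrm (y - y'))).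
    by rewrite ler_wpM2r ?nrm_ge0// lerDl.
  by rewrite mulrC -ltr_pdivlMr.
- move=> x /closure_nrm cx; apply/closure_nrm => e /cx[x' Xx' xx'].
  by exists (cstar x'); [exact: XS|rewrite -cstarB nrm_cstar].
Qed.

(** * The dense subalgebra spanned by the generators *)

Section Spanning.
Variables (R : realType) (r : nat) (A : finType) (M : 'I_r -> A -> A -> int).
Hypothesis adm : admissible M.
Variables (D : Type) (delta : D -> A) (B : cstarAlgType R).
Variable s : dword M delta -> dword M delta -> B.
Hypothesis s_rel : defining_relations s.

Definition span_family : set B :=
  [set x | exists2 L, fvalid (@dterminus r A M D delta) L & x = ev s L].

Lemma star_subalgebra_span : star_subalgebra span_family.
Proof.
split.
- by exists [::] => //; rewrite /ev big_nil.
- move=> a _ _ [L vL ->] [L' vL' ->].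
  exists ([seq (a * x.1, x.2) | x <- L] ++ L').
    by move=> x; rewrite mem_cat => /orP[/mapP[y /vL e ->]|/vL'].
  rewrite ev_cat /ev big_map scaler_sumr; congr (_ + _).
  by apply: eq_bigr => x _; rewrite scalerA.
- move=> _ _ [L vL ->] [L' vL' ->].
  have [K bL] := deg_bounded_ex L; have [K' bL'] := deg_bounded_ex L'.
  by have [P [vP _ eP]] := fsum_product adm vL vL' bL bL'; exists P; rewrite ?eP.
- move=> _ [L vL ->]; exists (fstar L); first exact: fvalid_fstar.
  by rewrite (ev_fstar (family_matrix_units adm s_rel) vL).
Qed.

Lemma span_dense : cstar_generated (generators s) = setT ->
  forall x (e : R), 0 < e -> exists2 y, span_family y & nrm (x - y) < e.
Proof.
move=> gen x; apply/closure_nrm.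
have : cstar_generated (generators s) x by rewrite gen.
apply; split; last first.
  move=> _ [u [v [uv ->]]]; apply: subset_closure; exists [:: (1, (u, v))].
    by move=> y; rewrite inE => /eqP->.
  by rewrite /ev big_seq1 scale1r.
split; first exact: closed_closure.
exact: star_subalgebra_closure star_subalgebra_span.
Qed.

End Spanning.

(** * Isometry and range of the canonical homomorphism *)

Theorem corollary5p10 (R : realType) (r : nat) (r_ge1 : (1 <= r)%N)
    (A : finType) (A_nonempty : (0 < #|A|)%N) (M : 'I_r -> A -> A -> int)
    (M_adm : admissible M)
    (D : countType) (D_nonempty : inhabited D) (delta : D -> A)
    (cA : cstarAlgType R) (s : dword M delta -> dword M delta -> cA)
    (cA_univ : is_universal_algebra s)
    (H : hilbertType R) (S : dword M delta -> dword M delta -> BH H)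
    (S_neq0 : forall u v, dterminus u = dterminus v -> S u v <> 0%R)
    (S_pi : partial_isometries S)
    (S_rel : defining_relations S) :
  exists! phi : cA -> BH H,
    star_iso_onto phi (cstar_generated (generators S)) /\
    (forall u v, dterminus u = dterminus v -> phi (s u v) = S u v).
Proof.
have [_ s_rel s_gen s_univ] := cA_univ.
have [phi [[hphi phiE] phiU]] := s_univ _ _ S_pi S_rel.
have phi_le := star_hom_contractive hphi.
have phi_ev L : fvalid (@dterminus r A M D delta) L -> phi (ev s L) = ev S L.
  move=> vL; rewrite /ev (star_hom_sum hphi) big_seq [RHS]big_seq.
  by apply: eq_bigr => x /vL h; rewrite (star_homZ hphi) phiE.
have iso x : nrm (phi x) = nrm x.
  apply/le_anti; rewrite phi_le /=; apply/ler_addgt0Pr => e e0.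
  (* With y in the span within e/2 of x: |x| <= e/2 + |y| <= e/2 + |phi y| <= e/2 + |phi x| +
     e/2. *)
  have [_ [L vL ->] xL] := span_dense M_adm s_rel s_gen x (divr_gt0 e0 (ltr0n _ 2)).
  rewrite -[x in leLHS](subrK (ev s L)) [e]splitr addrA addrC.
  apply: le_trans (nrmD _ _) _; apply: lerD; first exact: ltW.
  apply: le_trans (families_dominated M_adm s_rel S_rel S_neq0 vL) _.
  rewrite -phi_ev// (_ : ev s L = x + (ev s L - x)) ?(star_homD hphi); last first.
    by rewrite addrC subrK.
  apply: le_trans (nrmD _ _) _; rewrite lerD2l.
  by rewrite -(star_homD hphi); apply: le_trans (phi_le _) _; rewrite nrm_distC ltW.
exists phi; split=> [|psi [[hpsi _ _] psiE]]; last exact: phiU.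
split=> //; split=> //.
  move=> x y e; apply/subr0_eq/nrm_le0.
  by rewrite -iso (star_homB hphi) e subrr nrm0.
(* The preimage of a closed *-subalgebra containing all S_{u,v} is one containing all s_{u,v}, hence
   everything. Conversely the range is itself such a subalgebra, closed because [phi] is
   isometric. *)
apply/seteqP; split=> [_ [x _ <-] X [[clX sX] gX]|y]; last first.
  apply; split; last by move=> _ [u [v [uv ->]]]; exists (s u v) => //; exact: phiE.
  by split; [exact: closed_range|exact: star_subalgebra_range].
have : cstar_generated (generators s) x by rewrite s_gen.
apply: (_ : smallest _ _ `<=` phi @^-1` X).
apply: smallest_sub; first by split; [exact: closed_preimage|exact: star_subalgebra_preimage].
by move=> _ [u [v [uv ->]]] /=; rewrite phiE//; apply: gX; exists u, v.
Qed.
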